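(* For every integer $n\geq 3$, $$cr(K_{n}\times C_4)\leq 16\left\lfloor\frac{n}{2}\right\rfloor\left\lfloor\frac{n-1}{2}\right\rfloor\left\lfloor\frac{n-2}{2}\right\rfloor\left\lfloor\frac{n-3}{2}\right\rfloor+n(n-1)(2n-5).$$
   Context: The crossing number $cr(G)$ of a graph $G$ is the smallest number of pairwise crossings of edges among all drawings of $G$ in the plane. The Kronecker product $G\times H$ of graphs $G$ and $H$ has vertex set $V(G)\times V(H)$ and edge set $\{\{(a,x),(b,y)\} : \{a,b\}\in E(G),\ \{x,y\}\in E(H)\}$. $K_n$ is the complete graph on $n$ vertices and $C_4$ is the cycle on $4$ vertices. Thus $K_n\times C_4$ has vertices $0i,1i,2i,3i$ ($0\leq i\leq n-1$) and edges $(0i,1j),(1i,2j),(2i,3j),(3i,0j)$ for $0\leq i\neq j\leq n-1$. *)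

(* Defs.v *)
From HB Require Import structures.
From mathcomp Require Import all_boot all_order all_algebra.
From mathcomp Require Import all_classical all_reals all_analysis.
Set Implicit Arguments.
Unset Strict Implicit.
Unset Printing Implicit Defensive.
Import Order.TTheory GRing.Theory Num.Theory.
Import numFieldNormedType.Exports.
Local Open Scope classical_set_scope.
Local Open Scope ring_scope.

Record sgraph := SGraph {
  vertex : finType;
  adj : rel vertex;
  adj_sym : symmetric adj;
  adj_irrefl : irreflexive adj
}.

Definition edges (G : sgraph) : {set {set vertex G}} :=
  [set [set u; v]%SET | u in vertex G, v in vertex G & adj u v]%SET.

Definition complete_adj (n : nat) : rel 'I_n := fun i j => i != j.

Lemma complete_sym n : symmetric (@complete_adj n).
Proof. by move=> i j; rewrite /complete_adj eq_sym. Qed.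

Lemma complete_irrefl n : irreflexive (@complete_adj n).
Proof. by move=> i; rewrite /complete_adj eqxx. Qed.

Definition K (n : nat) : sgraph := SGraph (@complete_sym n) (@complete_irrefl n).

Definition C4_adj : rel 'I_4 :=
  fun i j => ((j == i.+1 %% 4 :> nat) || (i == j.+1 %% 4 :> nat))%N.

Lemma C4_sym : symmetric C4_adj.
Proof. by move=> i j; rewrite /C4_adj orbC. Qed.

Lemma C4_irrefl : irreflexive C4_adj.
Proof. by case=> [[|[|[|[|i]]]] hi]. Qed.

Definition C4 : sgraph := SGraph C4_sym C4_irrefl.

Section Kronecker.
Variables G H : sgraph.

Definition kronecker_adj : rel (vertex G * vertex H) :=
  fun a b => adj a.1 b.1 && adj a.2 b.2.

Lemma kronecker_sym : symmetric kronecker_adj.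
Proof. by move=> a b; rewrite /kronecker_adj adj_sym (adj_sym a.2). Qed.

Lemma kronecker_irrefl : irreflexive kronecker_adj.
Proof. by move=> a; rewrite /kronecker_adj adj_irrefl. Qed.

Definition kronecker : sgraph := SGraph kronecker_sym kronecker_irrefl.

End Kronecker.

Section CrossingNumber.
Variable R : realType.

(* Only the values of [curve e] on [0, 1], for e an edge, are meaningful; the
   direction in which an edge is traversed is left free. *)
Record drawing (G : sgraph) := Drawing {
  pos : vertex G -> R * R;
  curve : {set vertex G} -> R -> R * R;
  pos_inj : injective pos;
  curve_continuous : forall e, e \in edges G ->
    {within `[0, 1], continuous (curve e)};
  curve_inj : forall e, e \in edges G -> {in `[0, 1] &, injective (curve e)};
  curve_ends : forall e, e \in edges G ->
    [set curve e 0; curve e 1] = pos @` [set` e];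
  curve_avoids : forall e, e \in edges G ->
    forall (t : R) (v : vertex G), t \in `]0, 1[ -> curve e t <> pos v
}.

(* A crossing is an unordered pair of distinct edges, adjacent or not, together
   with a common point of their interiors. Hence a point where m edges meet
   accounts for 'C(m, 2) crossings, and tangential contacts are counted too, so
   that no general position assumption on drawings is needed. *)
Definition crossings (G : sgraph) (D : drawing G) :
    set ({set {set vertex G}} * (R * R)) :=
  [set c | exists e f, [/\ e \in edges G, f \in edges G, e != f,
     c.1 = [set e; f]%SET &
     (curve D e @` `]0, 1[ `&` curve D f @` `]0, 1[) c.2]].

(* The infimum ranges over drawings with finitely many crossings, so it is a
   minimum as soon as there is one, and +oo (never a junk value) otherwise. *)
Definition crossing_number (G : sgraph) : \bar R :=
  ereal_inf [set k%:R%:E | k in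
    [set k : nat | exists D : drawing G, (crossings D #= `I_k)%card]].

End CrossingNumber.

(* Main.v *)
Require Import Defs.
From HB Require Import structures.
From mathcomp Require Import all_boot all_order all_algebra.
From mathcomp Require Import all_classical all_reals all_analysis.
From mathcomp Require Import zify ring lra.
Set Implicit Arguments.
Unset Strict Implicit.
Unset Printing Implicit Defensive.
Import Order.TTheory GRing.Theory Num.Theory.
Import numFieldNormedType.Exports.
Local Open Scope ring_scope.

(* Write K_n x C_4 as the bipartite graph between the layers 0, 2 and the layers
   1, 3. A vertex of the first part is a ray in R^3, one of the second part the
   negative of a ray, and edges are geodesic arcs of the sphere of rays, which is
   then mapped to the plane. The rays of index i are s_i m_i and a perturbation of
   it (its clone), where m_i = (1, i, i^2) and s_i = (-1)^i; so a crossing of two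
   edges is a positive solution of a x - b z = c y - d w between four rays, and it
   determines the signs of their 3 x 3 determinants.
   For four distinct indices these are Vandermonde signs: 4 crossings of edges for
   each of the 16 choices of clones of a 4-set of indices a < b < c < d with
   a = b, c = d or a = d, b = c (mod 2), whence the first term of the bound.
   The other crossings involve a pair of clones of some index i, together with two
   rays on the same side of the plane they span. The perturbation is chosen such
   that each such plane halves the 2n - 2 remaining rays; for even n this forces it
   to separate two clones of some index f(i), and f(f(i)) <> i. Double counting
   then gives n(n-1)(2n-5) crossings, whatever the number of separated pairs. *)

(** * Counting index quadruples *)

Lemma sum2_recr (h : nat -> nat -> nat) n :
  (\sum_(a < n.+1) \sum_(b < n.+1) h a b =
   \sum_(a < n) \sum_(b < n) h a b
   + (\sum_(a < n) h n a + \sum_(a < n) h a n) + h n n)%N.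
Proof.
rewrite big_ord_recr big_ord_recr /=.
under eq_bigr do rewrite big_ord_recr /=.
by rewrite big_split /=; lia.
Qed.

(** Tuples are grouped by their largest entry. Peeling off the maximum of quadruples, triples and
    pairs in turn leaves sorted indices and a sum over the 24 orderings. *)
Lemma sum2_by_max (h : nat -> nat -> nat) n : (forall a, h a a = 0%N) ->
  (\sum_(a < n) \sum_(b < n) h a b =
   \sum_(c < n) \sum_(a < c) (h c a + h a c))%N.
Proof.
move=> h0; elim: n => [|n IH]; first by rewrite !big_ord0.
by rewrite [RHS]big_ord_recr -IH sum2_recr h0 addn0 /= big_split.
Qed.

Lemma sum3_by_max (h : nat -> nat -> nat -> nat) n :
  (forall a b, [/\ h a a b = 0, h a b a = 0 & h b a a = 0]%N) ->
  (\sum_(a < n) \sum_(b < n) \sum_(c < n) h a b c =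
   \sum_(d < n) \sum_(a < d) \sum_(b < d) (h d a b + h a d b + h a b d))%N.
Proof.
move=> h0; elim: n => [|n IH]; first by rewrite !big_ord0.
rewrite [RHS]big_ord_recr -IH /= big_ord_recr /= sum2_recr.
under eq_bigr do rewrite sum2_recr.
rewrite !big_split /=.
have z1 : (\sum_(a < n) h a n n = 0)%N by rewrite big1 // => i _; case: (h0 n i).
have z2 : (\sum_(a < n) h n n a = 0)%N by rewrite big1 // => i _; case: (h0 n i).
have z3 : (\sum_(a < n) h n a n = 0)%N by rewrite big1 // => i _; case: (h0 n i).
have [z4 _ _] := h0 n n.
under [X in _ = (_ + X)%N]eq_bigr do rewrite !big_split /=.
rewrite !big_split /= z1 z2 z3 z4; lia.
Qed.

Lemma sum4_by_max (h : nat -> nat -> nat -> nat -> nat) n :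
  (forall a b c d, ~~ uniq [:: a; b; c; d] -> h a b c d = 0%N) ->
  (\sum_(a < n) \sum_(b < n) \sum_(c < n) \sum_(d < n) h a b c d =
   \sum_(e < n) \sum_(a < e) \sum_(b < e) \sum_(c < e)
     (h e a b c + h a e b c + h a b e c + h a b c e))%N.
Proof.
move=> h0; elim: n => [|n IH]; first by rewrite !big_ord0.
have z a b c d : (a == b) || (a == c) || (a == d) || (b == c) || (b == d)
    || (c == d) -> h a b c d = 0%N.
  by move=> e; apply: h0; rewrite /= !inE; move: e; do !case: eqP.
have sum3_recr (k : nat -> nat -> nat -> nat) :
  (forall a b, [/\ k a a b = 0, k a b a = 0 & k b a a = 0]%N) ->
  (\sum_(a < n.+1) \sum_(b < n.+1) \sum_(c < n.+1) k a b c =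
   \sum_(a < n) \sum_(b < n) \sum_(c < n) k a b c +
   \sum_(a < n) \sum_(b < n) (k n a b + k a n b + k a b n))%N.
  by move=> k0; rewrite !sum3_by_max // big_ord_recr.
rewrite [RHS]big_ord_recr -IH /= big_ord_recr /=.
under eq_bigr => a _.
  rewrite sum3_recr; last by move=> x y; rewrite !z ?eqxx ?orbT.
  over.
rewrite sum3_recr; last by move=> x y; rewrite !z ?eqxx ?orbT.
rewrite [X in (_ + (_ + X))%N]big1 ?addn0; last first.
  by move=> i _; rewrite big1 // => j _; rewrite !z ?eqxx ?orbT.
under [X in _ = (_ + X)%N]eq_bigr => a _ do under eq_bigr => b _ do
  rewrite !big_split /=.
under [X in _ = (_ + X)%N]eq_bigr => a _ do rewrite !big_split /=.
under [X in (X + _)%N = _]eq_bigr => a _ do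
  under [X in (_ + X)%N]eq_bigr => b _ do rewrite !big_split /=.
under [X in (X + _)%N = _]eq_bigr => a _ do rewrite !big_split /=.
rewrite !big_split /=; lia.
Qed.

(* The signs of the determinants of three of the vectors in a positive relation
   a x - b z = c y - d w. *)
Definition cross_sign (T : Type) (chi : T -> T -> T -> bool) (x z y w : T) :=
  [&& chi x y w == chi z y w, chi x z w == chi y z w, chi x z y != chi w z y,
      chi z x w != chi y x w, chi z x y == chi w x y & chi y x z == chi w x z].

(* Sign of (-1)^(i+j+k) times the Vandermonde determinant of i, j, k. *)
Definition chi_idx (i j k : nat) : bool :=
  ~~ (odd i (+) odd j (+) odd k (+) (j < i) (+) (k < i) (+) (k < j))%N.

Definition cross_idx (i j k l : nat) : bool :=
  uniq [:: i; j; k; l] && cross_sign chi_idx i j k l.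

Definition balanced_parity (a b c d : nat) : bool :=
  (odd a == odd b) && (odd c == odd d) || (odd a == odd d) && (odd b == odd c).

(** Once the order is fixed, [chi_idx] depends on the parities only, which leaves 16 cases. The 8
    orderings are the symmetries of a relation p x + q w = r z + t y: exchange x and w, z and y, or
    the two sides. *)
Lemma cross_idx_sorted (a b c d : nat) : (a < b)%N -> (b < c)%N -> (c < d)%N ->
  ((cross_idx d c b a + cross_idx c d b a + cross_idx c b d a + cross_idx c b a d)
   + (cross_idx d b c a + cross_idx b d c a + cross_idx b c d a + cross_idx b c a d)
   + (cross_idx d b a c + cross_idx b d a c + cross_idx b a d c + cross_idx b a c d)
   + ((cross_idx d c a b + cross_idx c d a b + cross_idx c a d b + cross_idx c a b d)
   + (cross_idx d a c b + cross_idx a d c b + cross_idx a c d b + cross_idx a c b d)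
   + (cross_idx d a b c + cross_idx a d b c + cross_idx a b d c + cross_idx a b c d))
   = 8 * balanced_parity a b c d)%N.
Proof.
move=> ab bc cd.
have ac := ltn_trans ab bc; have bd := ltn_trans bc cd; have ad := ltn_trans ac cd.
have nlt x y : (x < y)%N -> (y < x)%N = false by lia.
have ne x y : (x < y)%N -> (x == y) = false by lia.
have ne' x y : (x < y)%N -> (y == x) = false by lia.
rewrite /cross_idx /cross_sign /chi_idx /balanced_parity /= !inE.
rewrite ab bc cd ac bd ad !(nlt _ _ ab, nlt _ _ bc, nlt _ _ cd, nlt _ _ ac,
  nlt _ _ bd, nlt _ _ ad).
rewrite !(ne _ _ ab, ne _ _ bc, ne _ _ cd, ne _ _ ac, ne _ _ bd, ne _ _ ad).
rewrite !(ne' _ _ ab, ne' _ _ bc, ne' _ _ cd, ne' _ _ ac, ne' _ _ bd, ne' _ _ ad).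
by case: (odd a); case: (odd b); case: (odd c); case: (odd d).
Qed.

Lemma sum_cross_idx n :
  (\sum_(i < n) \sum_(j < n) \sum_(k < n) \sum_(l < n) cross_idx i j k l =
   8 * \sum_(d < n) \sum_(c < d) \sum_(b < c) \sum_(a < b)
     balanced_parity a b c d)%N.
Proof.
have z a b c d : (a == b) || (a == c) || (a == d) || (b == c) || (b == d)
    || (c == d) -> cross_idx a b c d = false.
  move=> e; rewrite /cross_idx /= !inE; apply/negbTE.
  by move: e; do !case: eqP.
rewrite (@sum4_by_max (fun a b c d => nat_of_bool (cross_idx a b c d))); last first.
  by move=> a b c d /negbTE e; rewrite /cross_idx e.
rewrite big_distrr /=; apply: eq_bigr => d _.
rewrite (@sum3_by_max (fun a b c : nat => cross_idx d a b c + cross_idx a d b c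
   + cross_idx a b d c + cross_idx a b c d)%N); last first.
  by move=> a b; rewrite !z ?eqxx ?orbT.
rewrite big_distrr /=; apply: eq_bigr => c _.
rewrite (@sum2_by_max (fun a b : nat =>
  (cross_idx d c a b + cross_idx c d a b + cross_idx c a d b + cross_idx c a b d)
 + (cross_idx d a c b + cross_idx a d c b + cross_idx a c d b + cross_idx a c b d)
 + (cross_idx d a b c + cross_idx a d b c + cross_idx a b d c + cross_idx a b c d))%N);
  last by move=> a; rewrite !z ?eqxx ?orbT.
rewrite big_distrr /=; apply: eq_bigr => b _.
rewrite big_distrr /=; apply: eq_bigr => a _.
exact: cross_idx_sorted.
Qed.

Lemma sum_parity n (r : bool) : (\sum_(i < n) (odd i == r) = (n + ~~ r)./2)%N.
Proof.
elim: n => [|n IH]; first by rewrite big_ord0; case: r.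
by rewrite big_ord_recr /= IH; case: r {IH}; lia.
Qed.

(** Pairs a < b < n of equal parity: the summand is the number of such a. *)
Definition same_parity_pairs n := (\sum_(b < n) (b + ~~ odd b)./2)%N.
(** Pairs a < b < n in which b has the parity of n and a the opposite one. *)
Definition mixed_parity_pairs n := (\sum_(b < n) (odd b == odd n) * (b + odd n)./2)%N.

(** If c and d have the same parity, balance means that a and b agree; otherwise it forces b to
    agree with c and a with d. *)
Lemma sum_balanced_pairs (c d : nat) :
  (\sum_(b < c) \sum_(a < b) balanced_parity a b c d =
   if odd c == odd d then same_parity_pairs c else mixed_parity_pairs c)%N.
Proof.
case: eqP => [e|/eqP e].
  apply: eq_bigr => b _; rewrite -sum_parity; apply: eq_bigr => a _.
  rewrite /balanced_parity e eqxx andbT.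
  by case: (odd a); case: (odd b); case: (odd d).
rewrite /mixed_parity_pairs; apply: eq_bigr => b _.
rewrite /balanced_parity (negbTE e).
have -> : odd d = ~~ odd c by case: (odd c) (odd d) e => [] [].
case: eqP => _; rewrite ?mul1n ?mul0n; last by rewrite big1 // => a _; rewrite !andbF.
have := sum_parity b (~~ odd c); rewrite negbK => <-.
by apply: eq_bigr => a _; rewrite andbF andbT.
Qed.

Lemma same_parity_pairsE m :
  (same_parity_pairs m.*2 + m = m * m /\ same_parity_pairs m.*2.+1 = m * m)%N.
Proof.
elim: m => [|m [IH1 IH2]]; first by rewrite /same_parity_pairs big_ord1 big_ord0.
have -> : (same_parity_pairs m.+1.*2 + m.+1 = m.+1 * m.+1)%N.
  by rewrite /same_parity_pairs doubleS big_ord_recr -/(same_parity_pairs _) IH2 /=;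
    lia.
split=> //; rewrite /same_parity_pairs big_ord_recr /= -/(same_parity_pairs _).
rewrite /same_parity_pairs doubleS big_ord_recr -/(same_parity_pairs _) IH2 /=; lia.
Qed.

Lemma mixed_parity_pairsE m :
  (mixed_parity_pairs m.*2 * 2 + m = m * m
   /\ mixed_parity_pairs m.*2.+1 * 2 = m * m + m)%N.
Proof.
rewrite /mixed_parity_pairs /= odd_double /=.
elim: m => [|m [IH1 IH2]]; first by rewrite big_ord1 big_ord0.
rewrite doubleS; split; first by rewrite !big_ord_recr /= odd_double /=; lia.
by rewrite !(@big_ord_recr _ _ _ m.*2.+2) /= big_ord_recr /= odd_double /=; lia.
Qed.

Lemma sum_balanced_triples (d : nat) :
  let D := (\sum_(c < d) \sum_(b < c) \sum_(a < b) balanced_parity a b c d)%N in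
  let m := d./2 in
  (2 * D = if odd d then m * m * (m - 1) else m * (m - 1) * (m - 1))%N.
Proof.
move=> D m; rewrite /D.
under eq_bigr do rewrite sum_balanced_pairs.
(* The summand depends on the parity of c, so each induction step adds two values of c. *)
have E0 k : (2 * \sum_(c < k.*2) (if odd c == false then same_parity_pairs c
    else mixed_parity_pairs c) = k * (k - 1) * (k - 1))%N.
  elim: k => [|k IH]; first by rewrite big_ord0.
  rewrite doubleS !big_ord_recr /= odd_double /= !mulnDr IH.
  have [e1 _] := same_parity_pairsE k; have [_ e2] := mixed_parity_pairsE k.
  by case: k IH e1 e2 => [|k] IH e1 e2; rewrite ?subn1 /= in IH *; lia.
have E1 k : (2 * \sum_(c < k.*2.+1) (if odd c == true then same_parity_pairs c
    else mixed_parity_pairs c) = k * k * (k - 1))%N.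
  elim: k => [|k IH].
    by rewrite big_ord1 /= /mixed_parity_pairs big_ord0.
  rewrite doubleS 2!big_ord_recr /= odd_double /= !mulnDr IH.
  have [_ e1] := same_parity_pairsE k; have [e2 _] := mixed_parity_pairsE k.+1.
  rewrite doubleS in e2.
  by case: k IH e1 e2 => [|k] IH e1 e2; rewrite ?subn1 /= in IH *; lia.
have := odd_double_half d; rewrite -/m; case: (odd d) => /= <-.
  exact: E1.
exact: E0.
Qed.

(** The floors are m, m - 1, m - 1, m - 2 for n = 2m and m, m, m - 1, m - 1 for n = 2m + 1. The even
    case is an induction on m, and the odd case adds one value of d. *)
Lemma sum_balanced_quadruples (n : nat) :
  (4 * \sum_(d < n) \sum_(c < d) \sum_(b < c) \sum_(a < b) balanced_parity a b c d
   = (n %/ 2) * ((n - 1) %/ 2) * ((n - 2) %/ 2) * ((n - 3) %/ 2))%N.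
Proof.
pose D d := (\sum_(c < d) \sum_(b < c) \sum_(a < b) balanced_parity a b c d)%N.
rewrite -[X in (4 * X)%N]/(\sum_(d < n) D d)%N.
have DE d : (2 * D d = if odd d then d./2 * d./2 * (d./2 - 1)
  else d./2 * (d./2 - 1) * (d./2 - 1))%N by apply: sum_balanced_triples.
clearbody D.
have E m : (4 * \sum_(d < m.*2) D d = m * (m - 1) * (m - 1) * (m - 2))%N.
  elim: m => [|m IH]; first by rewrite big_ord0.
  rewrite doubleS !big_ord_recr /= !mulnDr IH.
  have := DE m.*2; have := DE m.*2.+1; rewrite /= odd_double /= uphalf_double doubleK.
  by case: m {IH} => [|[|m]]; rewrite ?subn1 ?subn2 /= => e1 e2; lia.
rewrite -(odd_double_half n); set m := n./2; case: (odd n) => /=; last first.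
  rewrite add0n E.
  have -> : (m.*2 %/ 2 = m)%N by lia.
  have -> : ((m.*2 - 1) %/ 2 = m - 1)%N by lia.
  have -> : ((m.*2 - 2) %/ 2 = m - 1)%N by lia.
  have -> : ((m.*2 - 3) %/ 2 = m - 2)%N by lia.
  by [].
rewrite add1n big_ord_recr /= mulnDr E.
have -> : (m.*2.+1 %/ 2 = m)%N by lia.
have -> : ((m.*2.+1 - 1) %/ 2 = m)%N by lia.
have -> : ((m.*2.+1 - 2) %/ 2 = m - 1)%N by lia.
have -> : ((m.*2.+1 - 3) %/ 2 = m - 1)%N by lia.
have := DE m.*2; rewrite odd_double doubleK; clear.
by case: m => [|[|m]]; rewrite ?subn1 ?subn2 /= => e; lia.
Qed.

Lemma sum_cross_idxE n :
  (\sum_(i < n) \sum_(j < n) \sum_(k < n) \sum_(l < n) cross_idx i j k l =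
   2 * ((n %/ 2) * ((n - 1) %/ 2) * ((n - 2) %/ 2) * ((n - 3) %/ 2)))%N.
Proof. by rewrite sum_cross_idx -sum_balanced_quadruples mulnA. Qed.

(** * Counting crossings from determinant signs *)

Lemma card_set_sum (T : finType) (p : pred T) :
  #|[set x | p x]| = (\sum_x (p x : nat))%N.
Proof. by rewrite -sum1dep_card big_mkcond; apply: eq_bigr => x _; case: (p x). Qed.

Lemma sum_clones (n : nat) (F : 'I_n -> nat) :
  (\sum_(z : 'I_n * bool) F z.1 = 2 * \sum_i F i)%N.
Proof.
rewrite -(pair_bigA _ (fun i (b : bool) => F i)) /= big_distrr /=.
by apply: eq_bigr => i _; rewrite big_bool /= mul2n -addnn.
Qed.

Lemma leq_card_setU4 (T : finType) (A B C D : {set T}) :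
  (#|A :|: B :|: C :|: D| <= #|A| + #|B| + #|C| + #|D|)%N.
Proof.
have [+ _] := leq_card_setU (A :|: B :|: C) D.
have [+ _] := leq_card_setU (A :|: B) C; have [+ _] := leq_card_setU A B; lia.
Qed.

Section CrossingCount.
Variables (n : nat) (g : 'I_n -> 'I_n * bool -> bool)
  (chi : 'I_n * bool -> 'I_n * bool -> 'I_n * bool -> bool).
Hypothesis chi_cycle : forall a b c, chi a b c = chi b c a.
Hypothesis chi_distinct : forall a b c,
  uniq [:: a.1; b.1; c.1] -> chi a b c = chi_idx a.1 b.1 c.1.
Hypothesis chi_clones : forall i b c, c.1 != i ->
  chi (i, b) (i, ~~ b) c = b (+) g i c.
Hypothesis halving : forall i, #|[set z | (z.1 != i) && g i z]| = n.-1.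

(* The plane of the clones of i separates the clones of j. *)
Definition separates (i j : 'I_n) := g i (j, false) != g i (j, true).

Hypothesis separates_asym : forall i j, i != j -> ~~ (separates i j && separates j i).

(* Crossings of x -> -z with y -> -w, as ordered pairs of edges. *)
Definition crossing_edges : {set ('I_n * bool) * ('I_n * bool) *
    (('I_n * bool) * ('I_n * bool))} :=
  [set o | [&& o.1.1.1 != o.1.2.1, o.2.1.1 != o.2.2.1,
    uniq [:: o.1.1; o.1.2; o.2.1; o.2.2]
    & cross_sign chi o.1.1 o.1.2 o.2.1 o.2.2]].

Lemma clone_eq (x y : 'I_n * bool) : x != y -> x.1 = y.1 -> y = (x.1, ~~ x.2).
Proof.
case: x y => [i b] [j c] /= ne e; move: ne; rewrite -e.
by case: b c => [] []; rewrite ?eqxx.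
Qed.

Lemma g_separates i z : (g i z == g i (z.1, ~~ z.2)) = ~~ separates i z.1.
Proof. by case: z => j [] /=; rewrite /separates negbK // eq_sym. Qed.

(** There are 2 (n - 1) rays of index other than i; [halving] puts n - 1 of them on one side, hence
    n - 1 on the other. *)
Lemma card_same_side i z : z.1 != i ->
  (\sum_w ((w.1 != i) && (g i w == g i z)) = n.-1)%N.
Proof.
move=> zi; have tot : (\sum_(w : 'I_n * bool) (w.1 != i) = 2 * n.-1)%N.
  rewrite (sum_clones (fun j : 'I_n => nat_of_bool (j != i))); congr (2 * _)%N.
  have := card_set_sum (fun j : 'I_n => j != i) => <-.
  by rewrite (_ : [set _ | _] = [set~ i]) ?cardsC1 ?card_ord //; apply/finset.setP =>
    j; rewrite !inE.
have /esym := halving i; rewrite card_set_sum => hT.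
have sT : (\sum_(w : 'I_n * bool) (w.1 != i) = n.-1 +
    \sum_(w : 'I_n * bool) ((w.1 != i) && ~~ g i w))%N.
  by rewrite hT -big_split; apply: eq_bigr => w _; case: (g i w); case: (_ != _).
case gz: (g i z).
  by rewrite hT; apply: eq_bigr => w _; case: (g i w).
have -> : n.-1 = (\sum_(w : 'I_n * bool) ((w.1 != i) && ~~ g i w))%N by lia.
by apply: eq_bigr => w _; case: (g i w).
Qed.

(** From the n - 1 rays on the side of z one discards z, and also its clone unless the plane of i
    separates the two. *)
Lemma card_same_side_distinct i z : z.1 != i ->
  (\sum_w ([&& w.1 != i, w.1 != z.1 & g i w == g i z]) + 1 + ~~ separates i z.1
   = n.-1)%N.
Proof.
move=> zi; rewrite -(card_same_side zi) (bigD1 z) //= [RHS](bigD1 z) //=.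
rewrite (bigD1 (z.1, ~~ z.2)) /=; last by case: z {zi} => i0 [] /=;
  rewrite xpair_eqE eqxx.
rewrite [X in _ = (_ + X)%N](bigD1 (z.1, ~~ z.2)) /=; last by case: z {zi} =>
  i0 [] /=; rewrite xpair_eqE eqxx.
rewrite !eqxx !andbF zi -g_separates [g i (z.1, _) == _]eq_sym.
rewrite (eq_bigr (fun w => nat_of_bool ((w.1 != i) && (g i w == g i z))));
  first by case: (g i z == _) => /=; lia.
move=> w /andP[wz wz']; case: (eqVneq w.1 z.1) => // e.
by case/eqP: wz'; rewrite (clone_eq _ (esym e)) // eq_sym.
Qed.

(** This number is never evaluated: it cancels in [crossing_arith]. *)
Definition unseparated := (\sum_(i < n) \sum_(j < n) ((j != i) && ~~ separates i j))%N.

Lemma sum_neq : (\sum_(i < n) \sum_(j < n) (j != i) = n * n.-1)%N.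
Proof.
under eq_bigr => i _.
  rewrite -card_set_sum (_ : [set _ | _] = [set~ i]); last by apply/finset.setP => j;
    rewrite !inE.
  rewrite cardsC1 card_ord; over.
by rewrite sum_nat_const card_ord.
Qed.

Definition same_side_triples :=
  [set t : 'I_n * (('I_n * bool) * ('I_n * bool)) |
    [&& t.2.1.1 != t.1, t.2.2.1 != t.1,
      t.2.2.1 != t.2.1.1 & g t.1 t.2.2 == g t.1 t.2.1]].

Lemma card_same_side_triples :
  (#|same_side_triples| + 2 * n * n.-1 + 2 * unseparated = 2 * n * n.-1 * n.-1)%N.
Proof.
rewrite card_set_sum -(pair_bigA _ (fun (i : 'I_n) (t : ('I_n * bool) * ('I_n *
  bool)) =>
  nat_of_bool [&& t.1.1 != i, t.2.1 != i, t.2.1 != t.1.1 & g i t.2 == g i t.1])) /=.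
have -> : (2 * unseparated = \sum_(i < n) \sum_(z : 'I_n * bool)
    ((z.1 != i) && ~~ separates i z.1))%N.
  rewrite /unseparated big_distrr; apply: eq_bigr => i _ /=.
  by rewrite (sum_clones (fun j : 'I_n => nat_of_bool ((j != i) && ~~ separates i j))).
have -> : (2 * n * n.-1 = \sum_(i < n) \sum_(z : 'I_n * bool) (z.1 != i))%N.
  rewrite -mulnA -sum_neq big_distrr; apply: eq_bigr => i _ /=.
  by rewrite (sum_clones (fun j : 'I_n => nat_of_bool (j != i))).
rewrite -!big_split /= big_distrl /=; apply: eq_bigr => i _.
rewrite -(pair_bigA _ (fun z w : 'I_n * bool =>
  nat_of_bool [&& z.1 != i, w.1 != i, w.1 != z.1 & g i w == g i z])) /=.
rewrite -!big_split /= big_distrl /=; apply: eq_bigr => z _.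
case zi: (z.1 != i); last by rewrite big1.
by rewrite mul1n -(card_same_side_distinct zi).
Qed.

Definition unseparated_pairs :=
  [set t : 'I_n * ('I_n * bool) |
    [&& t.2.1 != t.1, ~~ separates t.1 t.2.1 & ~~ separates t.2.1 t.1]].

(** By [separates_asym] at least one of (i, j) and (j, i) is unseparated, so the indicator of both
    being so, plus 1, is at most the sum of the two indicators. Each pair is then doubled by the
    choice of a clone of j. *)
Lemma card_unseparated_pairs : (#|unseparated_pairs| + 2 * n * n.-1 <= 4 *
  unseparated)%N.
Proof.
rewrite card_set_sum -(pair_bigA _ (fun (i : 'I_n) (z : 'I_n * bool) =>
  nat_of_bool [&& z.1 != i, ~~ separates i z.1 & ~~ separates z.1 i])) /=.
under eq_bigr => i _ do rewrite
  (sum_clones (fun j : 'I_n => nat_of_bool [&& j != i,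
    ~~ separates i j & ~~ separates j i])).
rewrite -big_distrr /= -mulnA -sum_neq -mulnDr -[4%N]/(2 * 2)%N -mulnA leq_mul2l /=.
rewrite mul2n -addnn {2}/unseparated [X in (_ <= _ + X)%N]exchange_big -!big_split
  leq_sum // => i _.
rewrite -!big_split leq_sum // => j _ /=.
rewrite [i == j]eq_sym; case: eqVneq => //= ne.
by have := separates_asym ne; case: (separates i j); case: (separates j i).
Qed.

(** For distinct indices the signs do not depend on the clones: 16 choices of clones for each
    quadruple counted by [sum_cross_idxE]. *)
Lemma card_crossing_edges_distinct :
  (#|[set o in crossing_edges |
      uniq [:: o.1.1.1; o.1.2.1; o.2.1.1; o.2.2.1]]| <=
   32 * ((n %/ 2) * ((n - 1) %/ 2) * ((n - 2) %/ 2) * ((n - 3) %/ 2)))%N.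
Proof.
pose S := [set o : ('I_n * bool) * ('I_n * bool) * (('I_n * bool) * ('I_n * bool)) |
  cross_idx o.1.1.1 o.1.2.1 o.2.1.1 o.2.2.1].
apply: (@leq_trans #|S|).
  apply: subset_leq_card; apply/fintype.subsetP => -[[x z] [y w]]; rewrite !inE /=.
  move=> /andP[/and4P[_ _ _ c] u]; rewrite /cross_idx.
  have u' : uniq [:: val x.1; val z.1; val y.1; val w.1].
    by have := map_inj_uniq val_inj [:: x.1; z.1; y.1; w.1] => /= ->.
  rewrite u' /=; move: c; rewrite /cross_sign.
  have := u; rewrite /= !inE !negb_or => /and4P[/and3P[a1 a2 a3] /andP[a4 a5] a6 _].
  have [b1 b2 b3] : [/\ z.1 != x.1, y.1 != x.1 & w.1 != x.1] by split; rewrite eq_sym.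
  have [b4 b5 b6] : [/\ y.1 != z.1, w.1 != z.1 & w.1 != y.1].
    by split; rewrite eq_sym.
  by rewrite !chi_distinct //= ?inE ?negb_or ?a1 ?a2 ?a3 ?a4 ?a5 ?a6 ?b1 ?b2 ?b3 ?b4
    ?b5 ?b6.
rewrite /S card_set_sum -(pair_bigA _ (fun p q : ('I_n * bool) * ('I_n * bool) =>
  nat_of_bool (cross_idx p.1.1 p.2.1 q.1.1 q.2.1))) /=.
rewrite -(pair_bigA _ (fun x z : ('I_n * bool) =>
  \sum_(q : ('I_n * bool) * ('I_n * bool)) cross_idx x.1 z.1 q.1.1 q.2.1)%N) /=.
under eq_bigr => x _. under eq_bigr => z _.
  rewrite -(pair_bigA _ (fun y w : 'I_n * bool =>
    nat_of_bool (cross_idx x.1 z.1 y.1 w.1))) /=.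
  under eq_bigr => y _ do rewrite (sum_clones (fun l : 'I_n =>
    nat_of_bool (cross_idx x.1 z.1 y.1 l))).
  rewrite (sum_clones (fun k : 'I_n => 2 * \sum_(l < n) cross_idx x.1 z.1 k l)%N).
  over.
  rewrite (sum_clones (fun j : 'I_n =>
    2 * \sum_(k < n) (2 * \sum_(l < n) cross_idx x.1 j k l))%N).
  over.
rewrite (sum_clones (fun i : 'I_n =>
  2 * \sum_(j < n) (2 * \sum_(k < n) (2 * \sum_(l < n) cross_idx i j k l)))%N).
under eq_bigr => i _. under eq_bigr => j _.
  rewrite -big_distrr /= mulnA; over.
  rewrite -big_distrr /= mulnA; over.
by rewrite -big_distrr /= sum_cross_idxE !mulnA.
Qed.

Lemma chi_clones_middle j b c : c.1 != j ->
  chi (j, b) c (j, ~~ b) = ~~ b (+) g j c.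
Proof.
move=> cj; rewrite chi_cycle chi_cycle.
by have := chi_clones (~~ b) cj; rewrite negbK.
Qed.

(* The sign conditions tell which of the clones x, y of i is which, so that the
   crossing is determined by i, z, w. *)
Lemma card_crossing_edges_tails :
  (#|[set o in crossing_edges | (o.2.1.1 == o.1.1.1) && (o.2.2.1 != o.1.2.1)]|
   <= #|same_side_triples|)%N.
Proof.
set S := [set _ in _ | _].
have SP x z y w : (x, z, (y, w)) \in S ->
  [/\ y = (x.1, ~~ x.2), z.1 != x.1, w.1 != x.1, w.1 != z.1 &
    [/\ chi z x y = chi w x y, chi x y w = chi z y w & uniq [:: x; z; y; w]]].
  rewrite !inE /= => /andP[/and4P[xz yw u /and5P[/eqP e _ _ _ /andP[/eqP e' _]]]
    /andP[/eqP xy zw]].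
  have xny : x != y by move: u; rewrite /= !inE; case: (x == y); rewrite ?orbT.
  have {}xy : y = (x.1, ~~ x.2) by apply: clone_eq; rewrite // (eqP xy).
  by split=> //; [rewrite eq_sym|rewrite eq_sym; move: yw; rewrite xy].
rewrite -(card_in_imset (f := fun o => (o.1.1.1, (o.1.2, o.2.2)))).
  apply: subset_leq_card; apply/fintype.subsetP =>
    _ /imsetP[[[x z] [y w]] /SP[ey zx wx wz [e _ _]] ->].
  rewrite inE /= zx wx wz; move: e; rewrite !(chi_cycle _ x) ey;
    case: x {ey} zx wx => i b /= zi wi.
  by rewrite !chi_clones //; case: b; case: (g i z); case: (g i w).
move=> [[x z] [y w]] [[x' z'] [y' w']] /SP[ey zx wx wz [_ e u]] /SP[ey' zx' wx' wz'
  [_ e' u']] /= [xx' zz' ww'].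
(* In [chi x y w = chi z y w] the left side flips with the label [x.2], while the right side depends
   on indices only. *)
have : x.2 = x'.2.
  move: e e'; rewrite -zz' -ww'.
  have ne b : uniq [:: z.1; (x.1, b).1; w.1].
    by rewrite /= !inE negb_or zx [z.1 == _]eq_sym wz [x.1 == _]eq_sym wx.
  rewrite (chi_distinct (a := z)) ?ey ?ne // (chi_distinct (a := z)) ?ey' ?ne //=;
    last first.
    by rewrite -xx'; apply: (ne true).
  rewrite -xx'; case: (x) (x') xx' wx => i b [i' b'] /= <- wi.
  by rewrite !chi_clones // => <-; case: (g i w); case: b; case: b'.
by case: (x) (x') xx' ey ey' => i b [i' b'] /= <- -> -> <-; rewrite zz' ww'.
Qed.

(** Tails and heads exchange roles: z and w are the clones of an index j, and the signs recover the
    label of z from j, x and y. *)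
Lemma card_crossing_edges_heads :
  (#|[set o in crossing_edges | (o.2.1.1 != o.1.1.1) && (o.2.2.1 == o.1.2.1)]|
   <= #|same_side_triples|)%N.
Proof.
set S := [set _ in _ | _].
have SP x z y w : (x, z, (y, w)) \in S ->
  [/\ w = (z.1, ~~ z.2), x.1 != z.1, y.1 != z.1, y.1 != x.1 &
    chi x z w = chi y z w /\ chi x y w = chi z y w].
  rewrite !inE /= => /andP[/and4P[xz yw u /and5P[/eqP e /eqP e' _ _ _]] /andP[xy /eqP
    zw]].
  have znw : z != w by move: u; rewrite /= !inE; case: (z == w); rewrite ?orbT ?andbF.
  have {}zw : w = (z.1, ~~ z.2) by apply: clone_eq.
  by split=> //; move: yw; rewrite zw.
rewrite -(card_in_imset (f := fun o => (o.1.2.1, (o.1.1, o.2.1)))).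
  apply: subset_leq_card; apply/fintype.subsetP =>
    _ /imsetP[[[x z] [y w]] /SP[ew xz yz xy [e _]] ->].
  rewrite inE /= xz yz xy; move: e; rewrite (chi_cycle x) (chi_cycle y) ew.
  case: z {ew} xz yz => j b /= xj yj.
  by rewrite !chi_clones //; case: b; case: (g j x); case: (g j y).
move=> [[x z] [y w]] [[x' z'] [y' w']] /SP[ew xz yz yx [_ e]] /SP[ew' xz' yz' yx' [_
  e']] /= [zz' xx' yy'].
have : z.2 = z'.2.
  move: e e'; rewrite -xx' -yy'.
  have ne b : uniq [:: x.1; y.1; (z.1, b).1].
    by rewrite /= !inE negb_or xz yz [x.1 == _]eq_sym yx.
  rewrite (chi_distinct (a := x)) ?ew ?ne // (chi_distinct (a := x)) ?ew' ?ne //=;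
    last first.
    by rewrite -zz'; apply: (ne true).
  rewrite -zz'; case: (z) (z') zz' yz => j b [j' b'] /= <- yj.
  by rewrite !chi_clones_middle // => ->; case: (g j y); case: b; case: b'.
by case: (z) (z') zz' ew ew' => j b [j' b'] /= <- -> -> <-; rewrite xx' yy'.
Qed.

(** Two of the sign conditions say that neither plane of clones separates the other two clones. A
    third one ties the label of x to that of z, so the index of x and the ray z determine the
    crossing. *)
Lemma card_crossing_edges_both :
  (#|[set o in crossing_edges | (o.2.1.1 == o.1.1.1) && (o.2.2.1 == o.1.2.1)]|
   <= #|unseparated_pairs|)%N.
Proof.
set S := [set _ in _ | _].
have SP x z y w : (x, z, (y, w)) \in S ->
  [/\ y = (x.1, ~~ x.2), w = (z.1, ~~ z.2), z.1 != x.1,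
     ~~ separates x.1 z.1 && ~~ separates z.1 x.1 & chi x y w = chi z y w].
  rewrite !inE /= => /andP[/and4P[xz yw u /and5P[/eqP e1 /eqP e2 _ _ /andP[/eqP e3
    _]]] /andP[/eqP xy /eqP zw]].
  have znw : z != w by move: u; rewrite /= !inE; case: (z == w); rewrite ?orbT ?andbF.
  have xny : x != y by move: u; rewrite /= !inE; case: (x == y); rewrite ?orbT ?andbF.
  have ey : y = (x.1, ~~ x.2) by apply: clone_eq.
  have ew : w = (z.1, ~~ z.2) by apply: clone_eq.
  split=> //; first by rewrite eq_sym.
  rewrite -!g_separates; move: e2 e3 xz;
    rewrite (chi_cycle x z w) (chi_cycle y z w) (chi_cycle z x y) (chi_cycle w x y).
  rewrite ey ew; case: (x) (z) => i b [j c] /= e2 e3 ij.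
  have ji : j != i by rewrite eq_sym.
  move: e2 e3; rewrite !chi_clones //=.
  by move=> /addbI -> /addbI ->; rewrite !eqxx.
have /card_in_imset <- : {in S &, injective (fun o => (o.1.1.1, o.1.2))}; last first.
  apply: subset_leq_card; apply/fintype.subsetP =>
    _ /imsetP[[[x z] [y w]] /SP[_ _ zx p _] ->].
  by rewrite inE /= zx.
move=> [[x z] [y w]] [[x' z'] [y' w']] /SP[ey ew zx p e] /SP[ey' ew' _ _ e'] /= [xx'
  zz'].
rewrite ey ew ey' ew' -zz' -xx'.
suff -> : x = x' by [].
move: e e'; rewrite ey ew ey' ew' -xx' -zz'.
case: (x) (x') (z) xx' zx p => i b [i' b'] [j c] /= <- ji /andP[p1 p2].
have gn : g j (i, ~~ b) = g j (i, ~~ b').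
  by move: p2; rewrite /separates negbK => /eqP; case: b b' => [] [].
rewrite !chi_clones // !chi_clones_middle 1?eq_sym // gn => <-.
by case: (g i _); case: b b' {gn} => [] [].
Qed.

(** What remains to exclude is an index shared by the tail of one edge and the head of the other.
    One such coincidence would require two equal values of [chi_idx] to differ; with two, each plane
    of clones would separate the other clones, against [separates_asym]. *)
Lemma crossing_edges_cover o : o \in crossing_edges ->
  [|| uniq [:: o.1.1.1; o.1.2.1; o.2.1.1; o.2.2.1],
      (o.2.1.1 == o.1.1.1) && (o.2.2.1 != o.1.2.1),
      (o.2.1.1 != o.1.1.1) && (o.2.2.1 == o.1.2.1)
    | (o.2.1.1 == o.1.1.1) && (o.2.2.1 == o.1.2.1)].
Proof.
case: o => [[x z] [y w]]; rewrite inE /= => oC; rewrite !inE; move: oC.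
move=> /and4P[xz yw u /and5P[_ /eqP e2 e3 e4 /andP[/eqP e5 _]]].
rewrite !negb_or xz yw /=.
case: (eqVneq y.1 x.1) => [yx|yx]; first by case: (w.1 == z.1); rewrite ?orbT.
case: (eqVneq w.1 z.1) => [wz|wz]; first by rewrite !orbT.
rewrite /= !orbF andbT.
case: (eqVneq x.1 w.1) => [xw|xw] /=; case: (eqVneq z.1 y.1) => [zy|zy] //=.
- have ew : w = (x.1, ~~ x.2).
    by apply: clone_eq => //; move: u; rewrite /= !inE; case: (x == w); rewrite ?orbT.
  have ey : y = (z.1, ~~ z.2).
    by apply: clone_eq => //; move: u; rewrite /= !inE; case: (z == y);
      rewrite ?orbT ?andbF.
  have := separates_asym xz;
    rewrite -[separates x.1 z.1]negbK -[separates z.1 x.1]negbK -!g_separates.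
  move: e3 e4; rewrite (chi_cycle x z y) (chi_cycle w z y) (chi_cycle z x w)
    (chi_cycle y x w) ew ey.
  case: (x) (z) xz => i b [j c] /= ij.
  have ji : j != i by rewrite eq_sym.
  rewrite !chi_clones //=.
  by case: b; case: c => /=; case: (g i (j, true)); case: (g i (j, false));
    case: (g j (i, true)); case: (g j (i, false)).
- case/negP: e3; have wz' : uniq [:: w.1; z.1; y.1].
    by rewrite /= !inE negb_or wz [w.1 == _]eq_sym yw zy.
  by rewrite !chi_distinct ?xw.
- case/negP: e4; have yx' : uniq [:: y.1; x.1; w.1] by rewrite /= !inE negb_or yx yw xw.
  by rewrite !chi_distinct ?zy.
Qed.

(** Twice the equation for W plus the inequality for V eliminates U and leaves 4 k (k - 1)^2 - 6 k
    (k - 1) = 2 k (k - 1) (2 k - 5). *)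
Lemma crossing_arith (k O D T H B W V U P : nat) : (O <= D + T + H + B)%N ->
  (3 <= k)%N -> (D <= 32 * P)%N -> (T <= W)%N -> (H <= W)%N -> (B <= V)%N ->
  (W + 2 * k * k.-1 + 2 * U = 2 * k * k.-1 * k.-1)%N ->
  (V + 2 * k * k.-1 <= 4 * U)%N ->
  (O <= 2 * (16 * P + k * ((k - 1) * (2 * k - 5))))%N.
Proof.
move=> hO /subnKC <-; move: (k - 3)%N => {}k hD hT hH hB.
have -> : (3 + k - 1 = k.+2)%N by lia.
have -> : (2 * (3 + k) - 5 = (2 * k).+1)%N by lia.
have -> : ((3+k).-1 = k.+2)%N by lia.
(* After the shift of k by 3, everything is linear in q and q * k. *)
set q := ((3 + k) * k.+2)%N.
have -> : (2 * (3 + k) * k.+2 * k.+2 = 2 * (q * k) + 4 * q)%N by rewrite /q; ring.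
have -> : (2 * (3 + k) * k.+2 = 2 * q)%N by rewrite /q; ring.
have -> : ((3 + k) * (k.+2 * (2 * k).+1) = 2 * (q * k) + q)%N by rewrite /q; ring.
move: (q * k)%N => r; clearbody q. lia.
Qed.

Lemma card_crossing_edges_le : (3 <= n)%N ->
  (#|crossing_edges| <= 2 * (16 * (n %/ 2) * ((n - 1) %/ 2) * ((n - 2) %/ 2)
     * ((n - 3) %/ 2) + n * (n - 1) * (2 * n - 5)))%N.
Proof.
move=> n3.
have : (#|crossing_edges| <=
    #|[set o in crossing_edges | uniq [:: o.1.1.1; o.1.2.1; o.2.1.1; o.2.2.1]]|
  + #|[set o in crossing_edges | (o.2.1.1 == o.1.1.1) && (o.2.2.1 != o.1.2.1)]|
  + #|[set o in crossing_edges | (o.2.1.1 != o.1.1.1) && (o.2.2.1 == o.1.2.1)]|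
  + #|[set o in crossing_edges | (o.2.1.1 == o.1.1.1) && (o.2.2.1 == o.1.2.1)]|)%N.
  apply: leq_trans (leq_card_setU4 _ _ _ _); apply: subset_leq_card;
    apply/fintype.subsetP => o oC; have := crossing_edges_cover oC.
  have mem (p : pred _) : (o \in [set o in crossing_edges | p o]) = p o.
    by rewrite finset.in_set oC.
  by rewrite !finset.in_setU !mem -!orbA.
move=> /crossing_arith le; rewrite -!mulnA; apply: le n3 _ _ _ _ _ _.
- by have := card_crossing_edges_distinct; rewrite -!mulnA.
- exact: card_crossing_edges_tails.
- exact: card_crossing_edges_heads.
- exact: card_crossing_edges_both.
- exact: card_same_side_triples.
- exact: card_unseparated_pairs.
Qed.

End CrossingCount.

(** * The rays *)

Section Vectors.
Variable T : comNzRingType.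
Implicit Types u v w : T * T * T.

Definition det3 u v w : T :=
  u.1.1 * (v.1.2 * w.2 - v.2 * w.1.2) - u.1.2 * (v.1.1 * w.2 - v.2 * w.1.1)
  + u.2 * (v.1.1 * w.1.2 - v.1.2 * w.1.1).

(** Nonzero exactly when u and v span a plane that misses the third axis, where [project] is
    singular. *)
Definition det2 u v : T := u.1.1 * v.1.2 - u.1.2 * v.1.1.

Definition scale3 (a : T) u : T * T * T := (a * u.1.1, a * u.1.2, a * u.2).

Definition add3 u v : T * T * T := (u.1.1 + v.1.1, u.1.2 + v.1.2, u.2 + v.2).

Definition moment (i : nat) : T * T * T := (1, i%:R, i%:R ^+ 2).

Lemma det3_moment (i j k : nat) : det3 (moment i) (moment j) (moment k) =
  (j%:R - i%:R) * (k%:R - i%:R) * (k%:R - j%:R).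
Proof. by rewrite /det3 /=; ring. Qed.

Lemma det3_cycle u v w : det3 u v w = det3 v w u.
Proof. by rewrite /det3; ring. Qed.

Lemma det3_swap u v w : det3 v u w = - det3 u v w.
Proof. by rewrite /det3; ring. Qed.

Section Points.
Variables (n : nat) (e half : T).

(** For odd n the tilt has order e and outweighs the displacement [e ^+ 2] of the second clone; its
    sign follows the parity of i. For even n it is a fraction of that displacement. [half] is a
    parameter because T is only a ring. *)
Definition tilt (i : 'I_n) : T :=
  if odd n then (-1) ^+ (~~ odd i) * e else half * e ^+ 2.

Definition direction (i : 'I_n) :=
  add3 (moment (ordS i)) (scale3 (tilt i) (moment (ordS (ordS i)))).

(* The clones of [i] are the moment curve point at [i], and a nearby point on a
   line that almost contains the moment curve point at [i + 1] (cyclically); the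
   tilt of this line is chosen so that it halves the other clones, which for even
   [n] forces it to pass between the two clones of [i + 1]. *)
Definition point (z : 'I_n * bool) : T * T * T :=
  scale3 ((-1) ^+ z.1)
    (add3 (moment z.1) (scale3 (z.2%:R * e ^+ 2) (direction z.1))).

Lemma det3_clones i v : det3 (point (i, false)) (point (i, true)) v =
  e ^+ 2 * det3 (moment i) (direction i) v.
Proof.
have s2 : ((-1) ^+ i) ^+ 2 = 1 :> T by rewrite sqrr_sign.
rewrite -[RHS]mul1r -s2 /point /det3 /= !mul0r; ring.
Qed.

(** This clone is a multiple of the main term of [direction i], so only the tilt contributes. *)
Lemma det3_direction_false (i : 'I_n) :
  det3 (moment i) (direction i) (point (ordS i, false)) =
  (-1) ^+ ordS i * - tilt i *
     det3 (moment i) (moment (ordS i)) (moment (ordS (ordS i))).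
Proof. by rewrite /point /direction /det3 /= !mul0r; ring. Qed.

Lemma det3_direction_true (i : 'I_n) (t := tilt i) (t' := tilt (ordS i))
    (m := moment i) (m' := moment (ordS i)) (m'' := moment (ordS (ordS i)))
    (m3 := moment (ordS (ordS (ordS i)))) :
  det3 m (direction i) (point (ordS i, true)) =
  (-1) ^+ ordS i * ((e ^+ 2 - t) * det3 m m' m''
    + e ^+ 2 * t' * (det3 m m' m3 + t * det3 m m'' m3)).
Proof. by rewrite /point /direction /det3 /= !mul1r -/t -/t'; ring. Qed.

End Points.
End Vectors.

(* Sign of [det3 (point (i, false)) (point (i, true)) (point z)] for small [e]. *)
Definition side (n : nat) (i : 'I_n) (z : 'I_n * bool) : bool :=
  ~~ odd z.1 (+) ((z.1 == ordS i) && (if odd n then odd i else ~~ z.2)).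

(** * Signs of determinants for small perturbations *)

Section Realization.
Variable R : realType.

(** Taking the perturbation as an indeterminate makes the determinants polynomials, whose lowest
    terms can be read off by ring identities. *)
Lemma horner_point n (e h : R) (z : 'I_n * bool) (p := point 'X h%:P z) :
  (p.1.1.[e], p.1.2.[e], p.2.[e]) = point e h z.
Proof.
rewrite /p /point /direction /tilt; case: (odd n); case: z.2 => /=;
  rewrite !(hornerE, rmorph_sign, hornerMn, horner_exp) /scale3 /add3 /=;
  by congr (_, _, _); ring.
Qed.

Lemma near0_gt0 (Q : {poly R}) : 0 < Q.[0] -> \forall e \near (0^'+)%classic, 0 < Q.[e].
Proof.
move=> Q0; apply: (@cvgr_gt _ _ _ _ _ Q.[0]) => //.
by apply: cvg_at_right_filter; exact: continuous_horner.
Qed.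

Lemma natrB_sign (i j : nat) : i != j ->
  exists2 d : R, 0 < d & j%:R - i%:R = (-1) ^+ (j < i)%N * d.
Proof.
case: ltngtP => // ij _.
  by exists (i%:R - j%:R); rewrite ?subr_gt0 ?ltr_nat ?expr1 ?mulN1r ?opprB.
by exists (j%:R - i%:R); rewrite ?subr_gt0 ?ltr_nat ?expr0 ?mul1r.
Qed.

Lemma det3_moment_sign (i j k : nat) : uniq [:: i; j; k] ->
  0 < (-1) ^+ ((j < i) (+) (k < i) (+) (k < j))%N * det3 (moment R i) (moment R j)
    (moment R k).
Proof.
rewrite /= !inE negb_or => /and3P[/andP[ij ik] jk _]; rewrite det3_moment.
have [a a0 ->] := natrB_sign ij; have [b b0 ->] := natrB_sign ik.
have [c c0 ->] := natrB_sign jk.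
suff -> : forall r s t : bool, (-1) ^+ (r (+) s (+) t) *
    ((-1) ^+ r * a * ((-1) ^+ s * b) * ((-1) ^+ t * c)) = a * b * c.
  by rewrite !mulr_gt0.
by do 3!case; rewrite /= ?expr0 ?expr1; ring.
Qed.

(** [Q] is [D] freed of its expected sign and of a power of the indeterminate, so the sign for small
    e > 0 is found by evaluation at 0. *)
Lemma near0_sign (b : bool) (D Q : {poly R}) k :
  0 < Q.[0] -> (-1) ^+ (~~ b) * D = 'X ^+ k * Q ->
  \forall e \near (0^'+)%classic, D.[e] != 0 /\ (0 < D.[e]) = b.
Proof.
move=> /near0_gt0 Q0 DQ; near=> e.
have : 0 < ((-1) ^+ (~~ b) * D).[e].
  by rewrite DQ hornerM hornerXn mulr_gt0 ?exprn_gt0 //; near: e.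
case: b {DQ} => /=; first by rewrite mul1r => d; rewrite gt_eqF.
by rewrite mulN1r hornerN oppr_gt0 => d; rewrite lt_eqF // ltNge ltW.
Unshelve. all: by end_near. Qed.

Section PointSigns.
Variable n : nat.
Notation P := (point ('X : {poly R}) (2^-1 : R)%:P : 'I_n * bool -> _).

Lemma horner0_point (z : 'I_n * bool) :
  ((P z).1.1.[0], (P z).1.2.[0], (P z).2.[0]) = scale3 ((-1) ^+ z.1) (moment R z.1).
Proof.
rewrite horner_point /point expr0n mulr0 /scale3 /add3 /= !mul0r.
by rewrite !addr0.
Qed.

Lemma horner_det3 (u v w : {poly R} * {poly R} * {poly R}) (e : R) :
  (det3 u v w).[e] = det3 (u.1.1.[e], u.1.2.[e], u.2.[e])
    (v.1.1.[e], v.1.2.[e], v.2.[e]) (w.1.1.[e], w.1.2.[e], w.2.[e]).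
Proof. by rewrite /det3 !hornerE. Qed.

Lemma det2_point_near (a b : 'I_n * bool) : a.1 != b.1 ->
  \forall e \near (0^'+)%classic, det2 (point e 2^-1 a) (point e 2^-1 b) != 0 :> R.
Proof.
move=> ab; pose D := det2 (P a) (P b).
have DE (e : R) : D.[e] = det2 (point e 2^-1 a) (point e 2^-1 b).
  by rewrite -!horner_point /D /det2 !hornerE.
have D0 : D.[0] != 0.
  rewrite DE -!horner_point !horner0_point /det2 /=.
  rewrite (_ : _ - _ = (-1) ^+ a.1 * (-1) ^+ b.1 * (b.1%:R - a.1%:R)); last by ring.
  by rewrite !mulf_neq0 ?signr_eq0 // subr_eq0 eqr_nat eq_sym.
have : \forall e \near (0^'+)%classic, D.[e] != 0 /\ (0 < D.[e]) = (0 < D.[0]).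
  apply: (near0_sign (k := 0) (Q := (-1) ^+ (~~ (0 < D.[0])) * D));
    last by rewrite mul1r.
  case: (ltgtP D.[0] 0) D0 => //= d _; first by rewrite expr1 mulN1r hornerN oppr_gt0.
  by rewrite expr0 mul1r.
by apply: filterS => e [+ _]; rewrite DE.
Qed.

(** At e = 0 both clones of i become (-1)^i times [moment i], and the determinant is a nonzero
    signed Vandermonde determinant, so no power of e has to be removed. *)
Lemma det3_point_near (a b c : 'I_n * bool) : uniq [:: a.1; b.1; c.1] ->
  \forall e \near (0^'+)%classic,
    let d := det3 (point e 2^-1 a) (point e 2^-1 b) (point e 2^-1 c) : R in
    d != 0 /\ (0 < d) = chi_idx a.1 b.1 c.1.
Proof.
move=> u; pose D := det3 (P a) (P b) (P c).
have DE (e : R) : D.[e] = det3 (point e 2^-1 a) (point e 2^-1 b) (point e 2^-1 c).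
  by rewrite horner_det3 !horner_point.
have : \forall e \near (0^'+)%classic, D.[e] != 0 /\ (0 < D.[e]) = chi_idx a.1 b.1 c.1.
  apply: (near0_sign (k := 0) (Q := (-1) ^+ (~~ chi_idx a.1 b.1 c.1) * D));
    last by rewrite mul1r.
  have u' : uniq [:: val a.1; val b.1; val c.1].
    by have := map_inj_uniq val_inj [:: a.1; b.1; c.1] => /= ->.
  have := det3_moment_sign u'; move: DE => _.
  rewrite hornerM horner_det3 !horner0_point.
  have -> : ((-1) ^+ (~~ chi_idx a.1 b.1 c.1) : {poly R}).[0] =
     (-1) ^+ a.1 * (-1) ^+ b.1 * (-1) ^+ c.1 *
     (-1) ^+ ((b.1 < a.1) (+) (c.1 < a.1) (+) (c.1 < b.1))%N.
    rewrite /chi_idx negbK -(signr_odd _ a.1) -(signr_odd _ b.1) -(signr_odd _ c.1)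
      -!signr_addb.
    by rewrite horner_exp hornerN hornerC -!addbA.
  move=> h; rewrite (_ : _ * _ = (-1) ^+ a.1 ^+ 2 * (-1) ^+ b.1 ^+ 2 * (-1) ^+ c.1 ^+
    2 *
   ((-1) ^+ ((b.1 < a.1) (+) (c.1 < a.1) (+) (c.1 < b.1))%N *
        det3 (moment R a.1) (moment R b.1) (moment R c.1))).
    by rewrite !sqrr_sign !mul1r.
  by rewrite /det3 /scale3 /=; ring.
by apply: filterS => e; rewrite DE.
Qed.

End PointSigns.

End Realization.

Lemma ordS_neq (n : nat) (i : 'I_n) : (3 <= n)%N ->
  (ordS i != i) && (ordS (ordS i) != i).
Proof.
move=> n3; have i_n := ltn_ord i; rewrite -!val_eqE /=.
have [lt|ge] := ltnP i.+1 n; last first.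
  have -> : i.+1 = n by lia.
  by rewrite modnn modn_small; lia.
rewrite (modn_small lt); have [lt'|ge'] := ltnP i.+2 n; first by rewrite modn_small;
  lia.
have -> : i.+2 = n by lia.
by rewrite modnn; lia.
Qed.

Lemma odd_ordS (n : nat) (i : 'I_n) : ~~ odd n -> odd (ordS i) = ~~ odd i.
Proof.
move=> en; have i_n := ltn_ord i; rewrite /=.
have [lt|ge] := ltnP i.+1 n; first by rewrite modn_small.
have e : i.+1 = n by lia.
by rewrite e modnn /= -[odd i]negbK -[~~ odd i]/(odd i.+1) e en.
Qed.

Section CloneSigns.
Variables (R : realType) (n : nat).
Hypothesis n3 : (3 <= n)%N.
Notation P := (point ('X : {poly R}) (2^-1 : R)%:P : 'I_n * bool -> _).

(** Since i and its successor are cyclically consecutive, (i, i + 1, j) has an even number of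
    inversions: this is Gale's evenness condition. *)
Lemma det3_moment_ordS (i j : 'I_n) : j != i -> j != ordS i ->
  0 < det3 (moment R i) (moment R (ordS i)) (moment R j).
Proof.
have i_n := ltn_ord i; have j_n := ltn_ord j; have /andP[Si _] := ordS_neq i n3.
rewrite -!val_eqE /= in Si *; move=> ji jS.
have := @det3_moment_sign R i (i.+1 %% n) j.
rewrite /= !inE negb_or eq_sym Si eq_sym ji eq_sym jS => /(_ isT).
rewrite (_ : _ (+) _ = false) ?expr0 ?mul1r //.
have [lt|ge] := ltnP i.+1 n.
  by rewrite (modn_small lt) in jS *; lia.
have -> : i.+1 = n by lia.
by rewrite modnn; lia.
Qed.

Lemma horner_moment (i : nat) (e : R) : ((moment {poly R} i).1.1.[e],
  (moment {poly R} i).1.2.[e], (moment {poly R} i).2.[e]) = moment R i.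
Proof. by rewrite /moment /= !(hornerE, hornerMn, horner_exp). Qed.

Lemma horner0_direction (i : 'I_n) (d := direction ('X : {poly R}) (2^-1)%:P i) :
  (d.1.1.[0], d.1.2.[0], d.2.[0]) = moment R (ordS i).
Proof.
rewrite /d /direction /tilt /add3 /scale3; case: (odd n) => /=;
by rewrite !(hornerE, hornerMn, horner_exp) /= !(mulr0, mul0r, addr0, expr2).
Qed.

(** At an index other than i and i + 1 the determinant has order 2 in e and the sign of
    [(-1) ^+ z.1]. At i + 1 that term vanishes and the tilt decides, at order 3 for odd n and 4 for
    even n. *)
Lemma det3_clones_near (i : 'I_n) (z : 'I_n * bool) : z.1 != i ->
  \forall e \near (0^'+)%classic,
    let d := det3 (point e 2^-1 (i, false)) (point e 2^-1 (i,
      true)) (point e 2^-1 z) : R in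
    d != 0 /\ (0 < d) = side i z.
Proof.
move=> zi; pose D := det3 (P (i, false)) (P (i, true)) (P z).
have DE (e : R) : D.[e] = det3 (point e 2^-1 (i, false)) (point e 2^-1 (i,
  true)) (point e 2^-1 z).
  by rewrite horner_det3 !horner_point.
suff [Q [k Q0 QE]] : exists Q : {poly R}, exists2 k,
    0 < Q.[0] & (-1) ^+ (~~ side i z) * D = 'X ^+ k * Q.
  by have := near0_sign Q0 QE; apply: filterS => e; rewrite DE.
have {DE} -> : D = 'X ^+ 2 * det3 (moment {poly R} i) (direction 'X (2^-1)%:P i) (P z).
  exact: det3_clones.
clear D.
have [zS|zS] := eqVneq z.1 (ordS i); last first.
  rewrite /side (negbTE zS) /= addbF negbK.
  exists ((-1) ^+ (odd z.1) * det3 (moment {poly R} i) (direction 'X (2^-1)%:P i) (P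
    z)).
  exists 2%N; last by rewrite mulrCA.
  rewrite hornerM horner_det3 horner_moment horner0_direction horner0_point.
  rewrite horner_exp hornerN hornerC signr_odd.
  rewrite (_ : _ * _ = (-1) ^+ z.1 ^+ 2 * det3 (moment R i) (moment R (ordS i))
    (moment R z.1)).
    by rewrite sqrr_sign mul1r det3_moment_ordS.
  by rewrite /det3 /scale3 /=; ring.
pose W := det3 (moment {poly R} i) (moment {poly R} (ordS i)) (moment {poly R} (ordS
  (ordS i))).
have W0 : 0 < W.[0].
  rewrite horner_det3 !horner_moment det3_moment_ordS //.
    by have /andP[] := ordS_neq i n3.
  by have /andP[] := ordS_neq (ordS i) n3.
pose W3 := det3 (moment {poly R} i) (moment {poly R} (ordS i)) (moment {poly R} (ordS
  (ordS (ordS i)))).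
pose W4 := det3 (moment {poly R} i) (moment {poly R} (ordS (ordS i))) (moment {poly
  R} (ordS (ordS (ordS i)))).
pose s : {poly R} := (-1) ^+ ordS i.
pose r (j : 'I_n) : {poly R} := (-1) ^+ (~~ odd j); pose h : {poly R} := (2^-1)%:P.
case: z zi zS => j [] /= ji jS; rewrite jS.
  rewrite det3_direction_true -/W -/W3 -/W4 -/s; clearbody W W3 W4.
  rewrite /side /= eqxx /= /tilt; case on : (odd n) => /=;
    set c : {poly R} := (-1) ^+ (~~ (_ (+) _)).
    have cs : c * s * r i = -1.
      rewrite /c /s /r -(signr_odd _ (ordS i)) -!signr_addb /=.
      by case: (odd (i.+1 %% n)); case: (odd i).
    (* The displacement of the clone is of higher order than the tilt, so both clones of i + 1 get
       the same sign. *)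
    exists (- (c * s * r i) * W + 'X * (c * s) * (W + 'X * r (ordS i) * (W3 + r i *
      'X * W4))).
    exists 3%N; last by rewrite -/(r i) -/(r (ordS i)); ring.
    by rewrite cs opprK mul1r !hornerE ?mul0r ?addr0.
  have cs : c * s = 1.
    rewrite /c /s -(signr_odd _ (ordS i)) -!signr_addb /=.
    by case: (odd (i.+1 %% n)).
  (* Displacement and tilt have the same order: the coefficient is [1 - h] here and [- h] for the
     other clone, so the plane passes between them. *)
  exists (c * s * (1 - h) * W + 'X * (c * s) * (h * 'X * (W3 + h * 'X ^+ 2 * W4))).
  exists 4%N; last by rewrite -/h; ring.
  rewrite cs mul1r !hornerE ?mul0r ?addr0 mulr_gt0 //; lra.
rewrite det3_direction_false -/W -/s; clearbody W; rewrite /side /= eqxx /= /tilt.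
case on : (odd n) => /=; set c : {poly R} := (-1) ^+ (~~ (_ (+) _)).
  have cs : c * s * r i = -1.
    rewrite /c /s /r -(signr_odd _ (ordS i)) -!signr_addb /=.
    by case: (odd (i.+1 %% n)); case: (odd i).
  exists (- (c * s * r i) * W); exists 3%N; first by rewrite cs opprK mul1r.
  by rewrite -/(r i); ring.
have cs : c * s = -1.
  rewrite /c /s -(signr_odd _ (ordS i)) -!signr_addb /=.
  by case: (odd (i.+1 %% n)).
exists (- (c * s) * h * W); exists 4%N; last by rewrite -/h; ring.
by rewrite cs opprK mul1r !hornerE mulr_gt0 // invr_gt0.
Qed.

End CloneSigns.

(** Away from i + 1, both clones of each even index count. For even n exactly one of i and i + 1 is
    even, which leaves n - 2 rays, and the separated clones of i + 1 add one. For odd n there are n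
    + 1 rays of even index; two are lost by omitting i if i is even, and by the flip at i + 1 if i
    is odd. *)
Lemma side_halving (n : nat) (i : 'I_n) : (3 <= n)%N ->
  #|[set z | (z.1 != i) && side i z]| = n.-1.
Proof.
move=> n3; have /andP[Si SSi] := ordS_neq i n3.
have total : (\sum_(j < n) 2 * ~~ odd j = 2 * (n.+1)./2)%N.
  rewrite -big_distrr; congr (2 * _)%N; rewrite -[n.+1]addn1 -[1%N]/(~~ false : nat).
  by rewrite -sum_parity; apply: eq_bigr => j _; case: (odd j).
rewrite card_set_sum -(pair_bigA _ (fun (j : 'I_n) (b : bool) =>
  nat_of_bool ((j != i) && side i (j, b)))) /=.
rewrite (bigD1 i) //= (bigD1 (ordS i)) //= in total.
rewrite (bigD1 i) //= (bigD1 (ordS i)) //= !big_bool /side /= !eqxx Si /=.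
under eq_bigr => j /andP[ji jS].
  rewrite big_bool (negbTE jS) ji /= addbF addnn -mul2n; over.
have i_n := ltn_ord i.
move: (\sum_(_ < _ | _) _)%N total => S.
case: ifP => on total; last first.
  have := odd_ordS i (negbT on); rewrite /= => oS; rewrite oS in total *.
  by case: (odd i) total => /=; lia.
case oi : (odd i) total => /=; last by case: (odd _); lia.
(* For odd n the last index is even, so the successor of an odd i does not wrap around. *)
have -> : (i.+1 %% n = i.+1)%N.
  rewrite modn_small // ltnNge; apply/negP => ge.
  have en : n = i.+1 by lia.
  by move: on; rewrite en /= oi.
by rewrite /= oi /=; lia.
Qed.

(** For odd n nothing is separated; for even n only i + 1 is separated by i, and i + 2 differs from
    i cyclically. *)
Lemma side_separates_asym (n : nat) (i j : 'I_n) : (3 <= n)%N ->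
  ~~ (separates (@side n) i j && separates (@side n) j i).
Proof.
move=> n3; have /andP[Si SSi] := ordS_neq j n3.
rewrite /separates /side /=; case: (odd n); first by rewrite eqxx.
case: (eqVneq j (ordS i)) => [e|]; last by rewrite /= !addbF eqxx.
case: (eqVneq i (ordS j)) => [e'|]; last by rewrite /= !addbF eqxx andbF.
by move: SSi; rewrite -e' -e eqxx.
Qed.

(** Finitely many conditions, each valid for all small e > 0, hold for a common e. *)
Lemma exists_points (R : realType) (n : nat) : (3 <= n)%N ->
  exists p : 'I_n * bool -> R * R * R,
  [/\ forall a b, a.1 != b.1 -> det2 (p a) (p b) != 0,
      forall a b c, uniq [:: a.1; b.1; c.1] ->
        det3 (p a) (p b) (p c) != 0
        /\ (0 < det3 (p a) (p b) (p c)) = chi_idx a.1 b.1 c.1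
    & forall i z, z.1 != i -> det3 (p (i, false)) (p (i, true)) (p z) != 0
        /\ (0 < det3 (p (i, false)) (p (i, true)) (p z)) = side i z].
Proof.
move=> n3.
have h2 (t : ('I_n * bool) * ('I_n * bool)) : \forall e \near (0^'+)%classic,
    t.1.1 != t.2.1 -> det2 (point e 2^-1 t.1) (point e 2^-1 t.2) != 0 :> R.
  case: (boolP (t.1.1 != t.2.1)) => [/det2_point_near|_].
    by move=> /(_ R); apply: filterS.
  by apply: nearW.
have h3 (t : ('I_n * bool) * ('I_n * bool) * ('I_n * bool)) :
  \forall e \near (0^'+)%classic, uniq [:: t.1.1.1; t.1.2.1; t.2.1] ->
    let d := det3 (point e 2^-1 t.1.1) (point e 2^-1 t.1.2) (point e 2^-1 t.2) : R in
    d != 0 /\ (0 < d) = chi_idx t.1.1.1 t.1.2.1 t.2.1.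
  case: (boolP (uniq [:: t.1.1.1; t.1.2.1; t.2.1])) => [/det3_point_near|_].
    by move=> /(_ R); apply: filterS.
  by apply: nearW.
have hc (t : 'I_n * ('I_n * bool)) :
  \forall e \near (0^'+)%classic, t.2.1 != t.1 ->
    let d := det3 (point e 2^-1 (t.1, false)) (point e 2^-1 (t.1,
      true)) (point e 2^-1 t.2) : R in
    d != 0 /\ (0 < d) = side t.1 t.2.
  case: (boolP (t.2.1 != t.1)) => [/(det3_clones_near R n3)|_].
    by apply: filterS.
  by apply: nearW.
have [e [e2 e3 ec]] : exists e : R, [/\
    forall t : ('I_n * bool) * ('I_n * bool),
      t.1.1 != t.2.1 -> det2 (point e 2^-1 t.1) (point e 2^-1 t.2) != 0,
    forall t : ('I_n * bool) * ('I_n * bool) * ('I_n * bool),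
      uniq [:: t.1.1.1; t.1.2.1; t.2.1] ->
      let d := det3 (point e 2^-1 t.1.1) (point e 2^-1 t.1.2) (point e 2^-1 t.2) in
      d != 0 /\ (0 < d) = chi_idx t.1.1.1 t.1.2.1 t.2.1
  & forall t : 'I_n * ('I_n * bool), t.2.1 != t.1 ->
    let d := det3 (point e 2^-1 (t.1, false)) (point e 2^-1 (t.1,
      true)) (point e 2^-1 t.2) in
    d != 0 /\ (0 < d) = side t.1 t.2].
  near ((0 : R)^'+)%classic => e; exists e; split; near: e.
  - exact: (filter_forall _ h2).
  - exact: (filter_forall _ h3).
  - exact: (filter_forall _ hc).
exists (point e 2^-1); split=> [a b|a b c|i z]; first exact: (e2 (a, b)).
- exact: (e3 (a, b, c)).
- exact: (ec (i, z)).
Unshelve. all: by end_near. Qed.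

(** * Geodesic drawings *)

Section Geodesics.
Variable R : realType.
Implicit Types u v w : R * R * R.

Definition width v : R := `|v.1.1| + `|v.1.2|.

(* Maps the rays from the origin other than those of the third coordinate axis
   injectively to the plane; continuity off that axis is all the drawing needs. *)
Definition project v : R * R :=
  (v.1.1 / width v * expR (v.2 / width v), v.1.2 / width v * expR (v.2 / width v)).

(** Since [project] is constant on rays, this segment stands for the geodesic arc between two
    rays. *)
Definition chord u v (t : R) := add3 (scale3 (1 - t) u) (scale3 t v).

Lemma width_gt0 v : (0 < width v) = (width v != 0).
Proof. by rewrite lt_def addr_ge0 ?andbT. Qed.

(** The absolute values of the two coordinates of [project v] add up to [expR (v.2 / width v)]; this
    recovers the normalized height, and then the other coordinates. *)
Lemma project_inj v w : width v != 0 -> width w != 0 -> project v = project w ->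
  exists2 c, 0 < c & v = scale3 c w.
Proof.
move=> v0 w0 [e1 e2].
have normE x : width x != 0 -> `|x.1.1 / width x * expR (x.2 / width x)| +
    `|x.1.2 / width x * expR (x.2 / width x)| = expR (x.2 / width x).
  move=> x0; have x1 : 0 < width x by rewrite width_gt0.
  rewrite !normrM normfV (gtr0_norm x1) (gtr0_norm (expR_gt0 _)) -!mulrDl.
  by rewrite -/(width x) divff // mul1r.
have e3 : v.2 / width v = w.2 / width w.
  by apply: expR_inj; rewrite -(normE v v0) -(normE w w0) e1 e2.
rewrite e3 in e1 e2; have E0 := lt0r_neq0 (expR_gt0 (w.2 / width w)).
move/(mulIf E0) in e1; move/(mulIf E0) in e2.
exists (width v / width w); first by rewrite divr_gt0 // width_gt0.
case: v v0 e1 e2 e3 => [[v1 v2] v3] v0 /= e1 e2 e3; rewrite /scale3; congr (_, _, _).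
- by rewrite mulrAC -mulrA -e1 mulrC divfK.
- by rewrite mulrAC -mulrA -e2 mulrC divfK.
- by rewrite mulrAC -mulrA -e3 mulrC divfK.
Qed.

Lemma det2_combination u v (a b : R) : det2 u v != 0 ->
  a * u.1.1 + b * v.1.1 = 0 -> a * u.1.2 + b * v.1.2 = 0 -> a = 0 /\ b = 0.
Proof.
move=> d0 e1 e2; split; apply: (mulIf d0); rewrite mul0r /det2.
  rewrite (_ : _ * _ = (a * u.1.1 + b * v.1.1) * v.1.2 - (a * u.1.2 + b * v.1.2) *
    v.1.1); last by ring.
  by rewrite e1 e2 !mul0r subr0.
rewrite (_ : _ * _ = (a * u.1.2 + b * v.1.2) * u.1.1 - (a * u.1.1 + b * v.1.1) *
  u.1.2); last by ring.
by rewrite e1 e2 !mul0r subr0.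
Qed.

(** Cramer's rule: putting the vanishing combination in place of one vector multiplies the
    determinant by its coefficient. *)
Lemma det3_combination u v w (a b c : R) : det3 u v w != 0 ->
  a * u.1.1 + b * v.1.1 + c * w.1.1 = 0 ->
  a * u.1.2 + b * v.1.2 + c * w.1.2 = 0 ->
  a * u.2 + b * v.2 + c * w.2 = 0 -> [/\ a = 0, b = 0 & c = 0].
Proof.
move=> d0 e1 e2 e3.
pose r : R * R * R := (a * u.1.1 + b * v.1.1 + c * w.1.1,
  a * u.1.2 + b * v.1.2 + c * w.1.2, a * u.2 + b * v.2 + c * w.2).
have r0 : r = (0, 0, 0) by rewrite /r e1 e2 e3.
split; apply: (mulIf d0); rewrite mul0r.
- by rewrite -(_ : det3 r v w = a * det3 u v w);
  [rewrite r0 /det3 /=|rewrite /r /det3 /=]; ring.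
- by rewrite -(_ : det3 u r w = b * det3 u v w);
  [rewrite r0 /det3 /=|rewrite /r /det3 /=]; ring.
- by rewrite -(_ : det3 u v r = c * det3 u v w);
  [rewrite r0 /det3 /=|rewrite /r /det3 /=]; ring.
Qed.

Lemma width_chord u v t : det2 u v != 0 -> width (chord u v t) != 0.
Proof.
move=> d0; apply/eqP => /eqP; rewrite paddr_eq0 // !normr_eq0 =>
  /andP[/eqP /= e1 /eqP /= e2].
by have [a b] := det2_combination d0 e1 e2; lra.
Qed.

Lemma chord_inj u v s t c : det2 u v != 0 ->
  chord u v s = scale3 c (chord u v t) -> s = t.
Proof.
move=> d0 [e1 e2 _].
have [||a b] := @det2_combination u v (1 - s - c * (1 - t)) (s - c * t) d0.
- by move: e1 => /=; lra.
- by move: e2 => /=; lra.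
have c1 : c = 1 by lra.
by rewrite c1 in b; lra.
Qed.

Lemma continuous_project_chord u v : det2 u v != 0 ->
  continuous (fun t => project (chord u v t)).
Proof.
move=> d0 t; have w0 := width_chord t d0.
have lin (a b : R) : {for t, continuous (fun s : R => (1 - s) * a + s * b)}.
  apply: continuousD; apply: continuousM; try exact: cvg_cst; try exact: cvg_id.
  by apply: continuousB; [exact: cvg_cst|exact: cvg_id].
have cw : {for t, continuous (fun s : R => width (chord u v s))}.
  apply: continuousD.
    by apply: (continuous_comp (lin _ _)); exact: norm_continuous.
  by apply: (continuous_comp (lin _ _)); exact: norm_continuous.
have ci : {for t, continuous (fun s : R => (width (chord u v s))^-1)}.
  exact: continuousV.
have cq (a b : R) : {for t, continuous (fun s : R =>
  ((1 - s) * a + s * b) / width (chord u v s))}.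
  exact: (continuousM (lin a b) ci).
have ce : {for t, continuous (fun s : R =>
  expR ((chord u v s).2 / width (chord u v s)))}.
  apply: continuous_comp; last exact: continuous_expR.
  exact: (cq u.2 v.2).
have c1 : {for t, continuous (fun s : R => (project (chord u v s)).1)}.
  exact: (continuousM (cq u.1.1 v.1.1) ce).
have c2 : {for t, continuous (fun s : R => (project (chord u v s)).2)}.
  exact: (continuousM (cq u.1.2 v.1.2) ce).
exact: (cvg_pair c1 c2).
Qed.

End Geodesics.

Section GeodesicDrawing.
Variables (R : realType) (G : sgraph) (q : vertex G -> R * R * R).
Hypothesis q_width : forall u : vertex G, width (q u) != 0.
Hypothesis q_inj : forall (u v : vertex G) c, 0 < c -> q u = scale3 c (q v) -> u = v.
Hypothesis q_adj : forall u v : vertex G, adj u v -> det2 (q u) (q v) != 0.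
Hypothesis q_avoid : forall (u v w : vertex G) t c, adj u v -> 0 < t < 1 -> 0 < c ->
  chord (q u) (q v) t <> scale3 c (q w).

Lemma edgeP (e : {set vertex G}) : e \in edges G ->
  exists u v, adj u v /\ e = [set u; v]%SET.
Proof. by case/imset2P => u v _; rewrite inE => /andP[_ uv] ->; exists u, v. Qed.

(** Either order of the ends may be picked, as a drawing leaves the direction free; [None] only
    occurs for sets that are not edges. *)
Definition edge_ends (e : {set vertex G}) : option (vertex G * vertex G) :=
  [pick p | adj p.1 p.2 && (e == [set p.1; p.2]%SET)].

Definition geodesic (e : {set vertex G}) (t : R) : R * R :=
  if edge_ends e is Some p then project (chord (q p.1) (q p.2) t) else (0, 0).

Lemma geodesicP (e : {set vertex G}) : e \in edges G ->
  exists u v, [/\ adj u v, e = [set u; v]%SET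
    & geodesic e = fun t => project (chord (q u) (q v) t)].
Proof.
move=> /edgeP[u [v [uv e_uv]]]; rewrite /geodesic /edge_ends.
case: pickP => [[u' v'] /andP[/= uv' /eqP e']|/(_ (u, v))].
  by exists u', v'.
by rewrite /= uv e_uv eqxx.
Qed.

Lemma geodesic_drawing : exists D : drawing R G, curve D = geodesic.
Proof.
have chord0 (u v : R * R * R) : chord u v 0 = u.
  by case: u => [[u1 u2] u3]; rewrite /chord /add3 /scale3 /=; congr (_, _, _); ring.
have chord1 (u v : R * R * R) : chord u v 1 = v.
  by case: v => [[v1 v2] v3]; rewrite /chord /add3 /scale3 /=; congr (_, _, _); ring.
unshelve eexists (@Drawing R G (fun w => project (q w)) geodesic _ _ _ _ _) => //.
- move=> u v /= e; have [c c0] := project_inj (q_width u) (q_width v) e.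
  exact: q_inj.
- move=> e /geodesicP[u [v [uv _ ->]]].
  by apply: continuous_subspaceT; apply: continuous_project_chord; exact: q_adj.
- move=> e /geodesicP[u [v [uv _ ->]]] s t _ _ est.
  have d0 := q_adj uv.
  have [c _] := project_inj (width_chord s d0) (width_chord t d0) est.
  exact: chord_inj.
- move=> e /geodesicP[u [v [uv -> ->]]]; rewrite chord0 chord1.
  apply/seteqP; split => [x /= [->|->]|x /= [w]].
  + by exists u => //=; rewrite !inE eqxx.
  + by exists v => //=; rewrite !inE eqxx orbT.
  + by rewrite /= !inE => /orP[] /eqP -> <-; [left|right].
- move=> e /geodesicP[u [v [uv _ ->]]] t w; rewrite in_itv /= => t01 etw.
  have [c c0] := project_inj (width_chord t (q_adj uv)) (q_width w) etw.
  exact: q_avoid.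
Qed.

End GeodesicDrawing.

(** * From ordered to unordered pairs of edges *)

Section CrossingSymmetry.
Variables (n : nat) (chi : 'I_n * bool -> 'I_n * bool -> 'I_n * bool -> bool).
Hypothesis chi_cycle : forall a b c, chi a b c = chi b c a.
Hypothesis chi_swap : forall a b c, uniq [:: a; b; c] -> chi b a c = ~~ chi a b c.

(** Alternation leaves four values of [chi], equal in pairs and opposite between the pairs.
    [cross_sign] lists six conditions because the count above assumes cyclic symmetry but not
    alternation. *)
Lemma cross_signE x z y w : uniq [:: x; z; y; w] -> cross_sign chi x z y w =
  [&& chi x y w == chi z y w, chi x z y == chi x z w & chi x y w != chi x z y].
Proof.
rewrite /= !inE !negb_or => /and4P[/and3P[xz xy xw] /andP[zy zw] yw _].
have e1 : chi y z w = ~~ chi z y w by apply: chi_swap;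
  rewrite /= !inE !negb_or zy zw yw.
have e2 : chi z x w = ~~ chi x z w by apply: chi_swap;
  rewrite /= !inE !negb_or xz xw zw.
have e3 : chi y x w = ~~ chi x y w by apply: chi_swap;
  rewrite /= !inE !negb_or xy xw yw.
have e4 : chi z x y = ~~ chi x z y by apply: chi_swap;
  rewrite /= !inE !negb_or xz xy zy.
have e5 : chi y x z = chi x z y by rewrite chi_cycle.
have e6 : chi w x z = chi x z w by rewrite chi_cycle.
have e7 : chi w z y = chi z y w by rewrite chi_cycle.
have e8 : chi w x y = chi x y w by rewrite chi_cycle.
rewrite /cross_sign e1 e2 e3 e4 e5 e6 e7 e8.
by case: (chi x y w); case: (chi z y w); case: (chi x z w); case: (chi x z y).
Qed.

Lemma crossing_edges_swap o :
  o \in crossing_edges chi -> (o.2, o.1) \in crossing_edges chi.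
Proof.
case: o => [[x z] [y w]]; rewrite !finset.in_set => /and4P /= [xz yw u].
have u' : uniq [:: y; w; x; z] by rewrite (uniq_catC [:: y; w] [:: x; z]).
rewrite cross_signE // => c; apply/and4P; split=> //; rewrite cross_signE //.
have e1 : chi y x z = chi x z y by rewrite chi_cycle.
have e2 : chi w x z = chi x z w by rewrite chi_cycle.
have e3 : chi y w x = chi x y w by rewrite [RHS]chi_cycle.
have e4 : chi y w z = chi z y w by rewrite [RHS]chi_cycle.
rewrite e1 e2 e3 e4; move: c.
by case: (chi x y w); case: (chi z y w); case: (chi x z w); case: (chi x z y).
Qed.

(** Each fibre of the map to unordered pairs contains an element together with its exchange. *)
Lemma card_crossing_edge_pairs (T : finType) (edge : ('I_n * bool) * ('I_n * bool) ->
  T) :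
  (2 * #|[set [set edge o.1; edge o.2] | o in crossing_edges chi]|
   <= #|crossing_edges chi|)%N.
Proof.
rewrite mulnC -sum_nat_const -[leqRHS]sum1_card.
rewrite (partition_big_imset (fun o => [set edge o.1; edge o.2])) /=.
apply: leq_sum => c /imsetP[t tC ->].
have ne : (t.2, t.1) != t.
  apply/eqP; case: t tC => [[x z] [y w]]; rewrite finset.in_set /= =>
    /and4P[_ _ + _] [xy _].
  by rewrite xy /= !inE eqxx orbT.
rewrite (bigD1 t) /=; last by rewrite tC eqxx.
by rewrite (bigD1 (t.2, t.1)) //= crossing_edges_swap // ne finset.setUC eqxx.
Qed.

End CrossingSymmetry.


(** [crossing_number] asks for an exact finite cardinality, which an injection of the crossings into
    a finite set provides. *)
Lemma card_inj_finset (T : Type) (U : finType) (A : set T) (X : {set U}) (f : T -> U) :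
  (forall a, A a -> f a \in X) -> {in A &, injective f} ->
  exists2 k, (A #= `I_k)%card & (k <= #|X|)%N.
Proof.
move=> AX finj; pose g a := index (f a) (enum X).
have ginj : {in A &, injective g}.
  move=> a b aA bA; have fa := AX _ (set_mem aA); have fb := AX _ (set_mem bA).
  move=> /(congr1 (nth (f a) (enum X))); rewrite !nth_index ?mem_enum // => fab.
  exact: finj.
have AI : (A #<= `I_#|X|)%card.
  rewrite -(card_le_eql (inj_card_eq ginj)); apply: subset_card_le => _ [a Aa <-] /=.
  by rewrite cardE index_mem mem_enum AX.
have /finite_setP[k Ak] := card_le_finite AI (finite_II _).
by exists k => //; rewrite -card_le_II -(card_le_eql Ak).
Qed.

(** * The drawing of the Kronecker product *)

Section KroneckerDrawing.
Variables (R : realType) (n : nat) (p : 'I_n * bool -> R * R * R).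
Hypothesis n3 : (3 <= n)%N.
Hypothesis p_det2 : forall a b, a.1 != b.1 -> det2 (p a) (p b) != 0.
Hypothesis p_distinct : forall a b c, uniq [:: a.1; b.1; c.1] ->
  det3 (p a) (p b) (p c) != 0 /\ (0 < det3 (p a) (p b) (p c)) = chi_idx a.1 b.1 c.1.
Hypothesis p_clones : forall i z, z.1 != i ->
  det3 (p (i, false)) (p (i, true)) (p z) != 0
  /\ (0 < det3 (p (i, false)) (p (i, true)) (p z)) = side i z.

Definition positive_det3 (a b c : 'I_n * bool) := 0 < det3 (p a) (p b) (p c).

Lemma det3_neq0_clones (a b c : 'I_n * bool) : a != b -> a.1 = b.1 -> c.1 != a.1 ->
  det3 (p a) (p b) (p c) != 0.
Proof.
move=> ab e ca; rewrite (clone_eq ab e); case: a ca {ab e} => i [] /= ci.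
  by rewrite det3_swap oppr_eq0; have [] := p_clones ci.
by have [] := p_clones ci.
Qed.

Lemma det3_neq0 (a b c : 'I_n * bool) : uniq [:: a; b;
  c] -> det3 (p a) (p b) (p c) != 0.
Proof.
rewrite /= !inE negb_or => /and3P[/andP[ab ac] bc _].
have [e|ab1] := eqVneq a.1 b.1.
  have [e'|ca] := eqVneq c.1 a.1; last exact: det3_neq0_clones.
  case: a b c ab ac bc e e' => [i r] [j s] [k t] /= + + + e e'; rewrite -e e'.
  by case: r s t => [] [] []; rewrite ?eqxx.
have [e|bc1] := eqVneq b.1 c.1.
  by rewrite det3_cycle; apply: det3_neq0_clones.
have [e|ca1] := eqVneq c.1 a.1.
  by rewrite -det3_cycle; apply: det3_neq0_clones; rewrite 1?eq_sym // e.
have [] // := p_distinct (a := a) (b := b) (c := c).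
by rewrite /= !inE negb_or ab1 bc1 eq_sym ca1.
Qed.

Lemma positive_det3_cycle a b c : positive_det3 a b c = positive_det3 b c a.
Proof. by rewrite /positive_det3 det3_cycle. Qed.

Lemma positive_det3_swap a b c : uniq [:: a; b; c] ->
  positive_det3 b a c = ~~ positive_det3 a b c.
Proof.
move=> /det3_neq0; rewrite /positive_det3 (det3_swap (p a)) oppr_gt0.
by case: ltgtP.
Qed.

Lemma positive_det3_clones i b c : c.1 != i ->
  positive_det3 (i, b) (i, ~~ b) c = b (+) side i c.
Proof.
move=> ci; have [d e] := p_clones ci; case: b => /=; last exact: e.
rewrite positive_det3_swap ?[X in ~~ X]e //.
rewrite /= !inE /= negb_or !xpair_eqE /= andbF andbT /=.
by case: c ci {d e} => j b /= ji; rewrite !xpair_eqE ![i == j]eq_sym (negbTE ji).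
Qed.

Lemma card_positive_crossings :
  (#|crossing_edges positive_det3| <= 2 * (16 * (n %/ 2) * ((n - 1) %/ 2) *
     ((n - 2) %/ 2) * ((n - 3) %/ 2) + n * (n - 1) * (2 * n - 5)))%N.
Proof.
apply: (@card_crossing_edges_le n (@side n)) => //.
- exact: positive_det3_cycle.
- by move=> a b c /p_distinct[].
- exact: positive_det3_clones.
- by move=> i; exact: side_halving.
- by move=> i j _; exact: side_separates_asym.
Qed.

(* The layers 0 and 2 are the two clones, the layers 1 and 3 their opposites. *)
Definition ray (v : 'I_n * 'I_4) : R * R * R :=
  scale3 ((-1) ^+ v.2) (p (v.1, (1 < v.2)%N)).

Definition even_vertex (x : 'I_n * bool) : 'I_n * 'I_4 :=
  (x.1, if x.2 then inord 2 else inord 0).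
Definition odd_vertex (x : 'I_n * bool) : 'I_n * 'I_4 :=
  (x.1, if x.2 then inord 3 else inord 1).

Lemma vertexP (v : 'I_n * 'I_4) : v = if odd v.2
  then odd_vertex (v.1, (1 < v.2)%N) else even_vertex (v.1, (1 < v.2)%N).
Proof.
case: v => i [[|[|[|[|//]]]] lt] /=; congr (_, _); apply: val_inj => /=;
by rewrite inordK.
Qed.

Lemma ray_even x : ray (even_vertex x) = p x.
Proof.
have s2 : (-1) ^+ 2 = 1 :> R by rewrite sqrrN expr1n.
by rewrite /ray; case: x => i [] /=; rewrite inordK // ?s2 ?expr0;
  case: (p _) => [[a b] c]; rewrite /scale3 /= !mul1r.
Qed.

Lemma ray_odd x : ray (odd_vertex x) = scale3 (-1) (p x).
Proof.
rewrite /ray; case: x => i [] /=; rewrite inordK //= ?expr1 //.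
by rewrite exprS sqrrN expr1n mulr1.
Qed.

Lemma kronecker_adjP (u v : 'I_n * 'I_4) : @adj (kronecker (K n) C4) u v ->
  u.1 != v.1 /\ odd v.2 = ~~ odd u.2.
Proof.
move=> /andP[uv c]; split=> //; move: c; rewrite /= /C4_adj.
by case: u v {uv} => i [[|[|[|[|//]]]] ?] [j [[|[|[|[|//]]]] ?]].
Qed.

Lemma exists_third (a b : 'I_n * bool) : a != b -> exists c, uniq [:: a; b; c].
Proof.
move=> ab; have : (#|[set a; b]%SET| < #|{: 'I_n * bool}|)%N.
  by rewrite cards2 ab card_prod card_ord card_bool; lia.
rewrite -(cardsC [set a; b]%SET) -[X in (X < _)%N]addn0 ltn_add2l card_gt0.
case/finset.set0Pn => c; rewrite !inE negb_or => /andP[ca cb]; exists c.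
by rewrite /= !inE negb_or ab [a == c]eq_sym ca [b == c]eq_sym cb.
Qed.

Lemma det2_ray u v : u.1 != v.1 -> det2 (ray u) (ray v) != 0.
Proof.
move=> uv; have := p_det2 (a := (u.1, (1 < u.2)%N)) (b := (v.1, (1 < v.2)%N)) uv.
rewrite /ray /det2 /scale3 /= => d0.
rewrite (_ : _ - _ = (-1) ^+ u.2 * (-1) ^+ v.2 * ((p (u.1, (1 < u.2)%N)).1.1 *
  (p (v.1, (1 < v.2)%N)).1.2 - (p (u.1, (1 < u.2)%N)).1.2 * (p (v.1,
    (1 < v.2)%N)).1.1)).
  by rewrite !mulf_neq0 ?signr_eq0.
ring.
Qed.

Lemma width_eq0 (v : R * R * R) : width v = 0 -> v.1.1 = 0 /\ v.1.2 = 0.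
Proof. by move/eqP; rewrite paddr_eq0 // !normr_eq0 => /andP[/eqP -> /eqP ->]. Qed.

Lemma width_ray v : width (ray v) != 0.
Proof.
apply/eqP => /width_eq0[e1 e2]; have /andP[Sv _] := ordS_neq v.1 n3.
have /det2_ray := (Sv : (ordS v.1, v.2).1 != v.1).
by rewrite /det2 e1 e2 !mulr0 subr0 eqxx.
Qed.

(** Distinct points belong to a basis, hence are not proportional. Over one point, layers of
    different parity carry opposite rays, which [0 < c] excludes. *)
Lemma ray_inj u v c : 0 < c -> ray u = scale3 c (ray v) -> u = v.
Proof.
move=> c0 uv; pose a := (u.1, (1 < u.2)%N); pose b := (v.1, (1 < v.2)%N).
have [ab|ab] := eqVneq a b; last first.
  have [d /det3_neq0 d0] := exists_third ab; case: uv => e1 e2 e3.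
  have [|||/eqP + _ _] := @det3_combination R (p a) (p b) (p d) ((-1) ^+ u.2) (- c *
    (-1) ^+ v.2) 0 d0.
  - by rewrite e1 -/b; ring.
  - by rewrite e2 -/b; ring.
  - by rewrite e3 -/b; ring.
  by rewrite signr_eq0.
have wa : width (ray u) != 0 := width_ray u.
have e : odd u.2 = odd v.2.
  apply/eqP/negPn/negP => o; case/eqP: wa.
  have ov : (-1) ^+ v.2 = - (-1) ^+ u.2 :> R.
    rewrite -signr_odd -[in RHS]signr_odd.
    by case: (odd u.2) (odd v.2) o => [] [] // _; rewrite /= ?expr0 ?expr1 ?opprK.
  case: uv; rewrite -/a -/b -ab ov => e1 e2 _; rewrite /width /ray /= -/a.
  have c1 : 1 + c != 0 by lra.
  have -> : (-1) ^+ u.2 * (p a).1.1 = 0 by apply: (mulfI c1);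
    rewrite mulr0 mulrDl mul1r {1}e1; ring.
  have -> : (-1) ^+ u.2 * (p a).1.2 = 0 by apply: (mulfI c1);
    rewrite mulr0 mulrDl mul1r {1}e2; ring.
  by rewrite normr0 addr0.
by rewrite (vertexP u) (vertexP v) -/a -/b ab e.
Qed.

(** Over a third point, w would contradict independence; over one of the ends, the coefficient of
    the other end would vanish, but it is [t] or [1 - t] up to sign. *)
Lemma ray_avoid u v w t c : u.1 != v.1 -> 0 < t < 1 -> 0 < c ->
  chord (ray u) (ray v) t <> scale3 c (ray w).
Proof.
move=> uv /andP[t0 t1] c0 [e1 e2 e3].
pose a := (u.1, (1 < u.2)%N); pose b := (v.1, (1 < v.2)%N); pose d := (w.1,
  (1 < w.2)%N).
have ab2 := p_det2 (uv : a.1 != b.1).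
have ab : a != b by apply: contraNneq uv => /(congr1 fst) /= ->.
rewrite -/a -/b -/d in e1 e2 e3.
have t1' : 1 - t != 0 by lra.
have t0' : t != 0 by lra.
have [da|da] := eqVneq d a.
  rewrite da in e1 e2.
  have [||_ /eqP] := @det2_combination R (p a) (p b)
    ((1 - t) * (-1) ^+ u.2 - c * (-1) ^+ w.2) (t * (-1) ^+ v.2) ab2.
  - by apply/eqP; move/eqP: e1; rewrite -subr_eq0 => /eqP <-; apply/eqP; ring.
  - by apply/eqP; move/eqP: e2; rewrite -subr_eq0 => /eqP <-; apply/eqP; ring.
  by rewrite mulf_eq0 signr_eq0 orbF (negbTE t0').
have [db|db] := eqVneq d b.
  rewrite db in e1 e2.
  have [||/eqP + _] := @det2_combination R (p a) (p b)
    ((1 - t) * (-1) ^+ u.2) (t * (-1) ^+ v.2 - c * (-1) ^+ w.2) ab2.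
  - by apply/eqP; move/eqP: e1; rewrite -subr_eq0 => /eqP <-; apply/eqP; ring.
  - by apply/eqP; move/eqP: e2; rewrite -subr_eq0 => /eqP <-; apply/eqP; ring.
  by rewrite mulf_eq0 signr_eq0 orbF (negbTE t1').
have d0 : det3 (p a) (p b) (p d) != 0.
  by apply: det3_neq0; rewrite /= !inE negb_or ab eq_sym da eq_sym db.
have [|||/eqP + _ _] := @det3_combination R (p a) (p b) (p d)
    ((1 - t) * (-1) ^+ u.2) (t * (-1) ^+ v.2) (- c * (-1) ^+ w.2) d0.
- by apply/eqP; move/eqP: e1; rewrite -subr_eq0 => /eqP <-; apply/eqP; ring.
- by apply/eqP; move/eqP: e2; rewrite -subr_eq0 => /eqP <-; apply/eqP; ring.
- by apply/eqP; move/eqP: e3; rewrite -subr_eq0 => /eqP <-; apply/eqP; ring.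
by rewrite mulf_eq0 signr_eq0 orbF (negbTE t1').
Qed.

(** A common point is a relation a x - s z = g y - d w with positive coefficients. The last
    conclusion fixes [s], so two edges meet at most once. *)
Lemma chord_crossing x z y w s t c : x.1 != z.1 -> y.1 != w.1 -> (x, z) != (y, w) ->
  0 < s < 1 -> 0 < t < 1 -> 0 < c ->
  chord (p x) (scale3 (-1) (p z)) s = scale3 c (chord (p y) (scale3 (-1) (p w)) t) ->
  [/\ (x, z, (y, w)) \in crossing_edges positive_det3,
     det3 (p x) (p y) (p w) != 0 &
     (1 - s) * det3 (p x) (p y) (p w) = s * det3 (p z) (p y) (p w)].
Proof.
move=> xz yw ne /andP[s0 s1] /andP[t0 t1] c0.
have a0 : 0 < 1 - s by lra.
have c0' : 0 < c * (1 - t) by rewrite mulr_gt0 // subr_gt0.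
have d0' : 0 < c * t by rewrite mulr_gt0.
move=> [e1 e2 e3].
have {}e1 : (1 - s) * (p x).1.1 = s * (p z).1.1 + c * (1 - t) * (p y).1.1 - c * t *
  (p w).1.1.
  by apply/eqP; rewrite -subr_eq0; move/eqP: e1; rewrite -subr_eq0 => /eqP <- /=;
    apply/eqP; ring.
have {}e2 : (1 - s) * (p x).1.2 = s * (p z).1.2 + c * (1 - t) * (p y).1.2 - c * t *
  (p w).1.2.
  by apply/eqP; rewrite -subr_eq0; move/eqP: e2; rewrite -subr_eq0 => /eqP <- /=;
    apply/eqP; ring.
have {}e3 : (1 - s) * (p x).2 = s * (p z).2 + c * (1 - t) * (p y).2 - c * t * (p w).2.
  by apply/eqP; rewrite -subr_eq0; move/eqP: e3; rewrite -subr_eq0 => /eqP <- /=;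
    apply/eqP; ring.
move: (1 - s) (c * (1 - t)) (c * t) a0 c0' d0' e1 e2 e3 =>
  a g d a0 g0 d0 e1 e2 e3 {c c0 t t0 t1}.
have neq1 (u v : 'I_n * bool) : u.1 != v.1 -> u != v by apply: contraNneq => ->.
have xz' := neq1 _ _ xz; have yw' := neq1 _ _ yw.
have uniq3 (u v o : 'I_n * bool) : u != v -> u != o -> v != o -> uniq [:: u; v; o].
  by move=> uv uo vo; rewrite /= !inE negb_or uv uo vo.
(* Any coincidence among the four rays turns the relation into one between independent vectors with
   a nonzero coefficient. *)
have xy : x != y.
  apply/eqP => xy; subst y.
  have zw : z != w by apply: contraNneq ne => ->.
  have [|||_ b0 _] := @det3_combination R (p x) (p z) (p w) (a - g) (- s) d
    (det3_neq0 (uniq3 _ _ _ xz' yw' zw)).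
  - by rewrite mulrBl e1; ring.
  - by rewrite mulrBl e2; ring.
  - by rewrite mulrBl e3; ring.
  by lra.
have zw : z != w.
  apply/eqP => zw; subst w.
  have [|||b0 _ _] := @det3_combination R (p x) (p y) (p z) a (- g) (- s + d)
    (det3_neq0 (uniq3 _ _ _ xy xz' yw')).
  - by rewrite e1; ring.
  - by rewrite e2; ring.
  - by rewrite e3; ring.
  by lra.
have xw : x != w.
  apply/eqP => xw; subst w; have [zy|zy] := eqVneq z y.
    subst y; have [||b0 _] := @det2_combination R (p x) (p z) (a + d) (- s - g)
      (p_det2 xz).
    - by rewrite mulrDl e1; ring.
    - by rewrite mulrDl e2; ring.
    by lra.
  have [|||b0 _ _] := @det3_combination R (p x) (p z) (p y) (a + d) (- s) (- g)
    (det3_neq0 (uniq3 _ _ _ xz' xy zy)).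
  - by rewrite mulrDl e1; ring.
  - by rewrite mulrDl e2; ring.
  - by rewrite mulrDl e3; ring.
  by lra.
have zy : z != y.
  apply/eqP => zy; subst y.
  have [|||b0 _ _] := @det3_combination R (p x) (p z) (p w) a (- s - g) d (det3_neq0
    (uniq3 _ _ _ xz' xw zw)).
  - by rewrite e1; ring.
  - by rewrite e2; ring.
  - by rewrite e3; ring.
  by lra.
have u4 : uniq [:: x; z; y; w] by rewrite /= !inE !negb_or xz' xy xw zy zw yw'.
have scaled : scale3 a (p x) = (s * (p z).1.1 + g * (p y).1.1 - d * (p w).1.1,
    s * (p z).1.2 + g * (p y).1.2 - d * (p w).1.2,
      s * (p z).2 + g * (p y).2 - d * (p w).2).
  by rewrite /scale3 e1 e2 e3.
(* Taking determinants of the relation with (y, w), (x, z) and (x, y) kills two of its four terms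
   each time. *)
have eA : a * det3 (p x) (p y) (p w) = s * det3 (p z) (p y) (p w).
  transitivity (det3 (scale3 a (p x)) (p y) (p w));
    first by rewrite /det3 /scale3 /=; ring.
  by rewrite scaled /det3 /=; ring.
have eB : g * det3 (p x) (p z) (p y) = d * det3 (p x) (p z) (p w).
  have : det3 (p x) (p z) (scale3 a (p x)) = 0 by rewrite /det3 /scale3 /=; ring.
  rewrite scaled => /eqP; rewrite -subr_eq0 => /eqP h; apply/eqP; rewrite -subr_eq0 -h.
  by apply/eqP; rewrite /det3 /=; ring.
have eC : d * det3 (p x) (p y) (p w) = - (s * det3 (p x) (p z) (p y)).
  have : det3 (p x) (p y) (scale3 a (p x)) = 0 by rewrite /det3 /scale3 /=; ring.
  rewrite scaled => h; apply/eqP; rewrite -subr_eq0 -oppr_eq0 -h.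
  by apply/eqP; rewrite /det3 /=; ring.
have n1 : det3 (p x) (p y) (p w) != 0 := det3_neq0 (uniq3 _ _ _ xy xw yw').
split=> //; rewrite finset.in_set; apply/and4P; split=> //=.
rewrite cross_signE //; last first.
- exact: positive_det3_swap.
- exact: positive_det3_cycle.
apply/and3P; split; rewrite /positive_det3.
- by rewrite -(pmulr_rgt0 _ a0) eA pmulr_rgt0.
- by rewrite -(pmulr_rgt0 _ g0) eB pmulr_rgt0.
rewrite -(pmulr_rgt0 _ d0) eC oppr_gt0 pmulr_rlt0 //.
by case: ltgtP (det3_neq0 (uniq3 _ _ _ xz' xy zy)).
Qed.

Definition Kn_C4 := kronecker (K n) C4.

Definition kronecker_ray : vertex Kn_C4 -> R * R * R := ray.

(** Replacing s by 1 - s where necessary makes every edge run from an even layer to an odd one,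
    whichever end [geodesic] starts from. *)
Lemma kronecker_edgeP (e : {set vertex Kn_C4}) : e \in edges Kn_C4 ->
  exists o : ('I_n * bool) * ('I_n * bool), [/\ o.1.1 != o.2.1,
    e = [set even_vertex o.1; odd_vertex o.2]%SET &
    forall y, (geodesic kronecker_ray e @` `]0, 1[)%classic y -> exists2 s, 0 < s < 1 &
      y = project (chord (p o.1) (scale3 (-1) (p o.2)) s)].
Proof.
move=> /(geodesicP kronecker_ray)[u [v [/kronecker_adjP[uv uv2] -> ->]]].
have flip (a b : R * R * R) s : chord a b s = chord b a (1 - s).
  by rewrite /chord /add3 /scale3 /=; congr (_, _, _); ring.
pose a := (u.1, (1 < u.2)%N); pose b := (v.1, (1 < v.2)%N).
rewrite /kronecker_ray (vertexP u) (vertexP v) -/a -/b uv2; case: (odd u.2) => /=.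
  exists (b, a); split; [by rewrite eq_sym|by rewrite finset.setUC|].
  move=> y [s]; rewrite /= in_itv /= => /andP[s0 s1] <-; exists (1 - s); first by lra.
  by rewrite flip ray_even ray_odd.
exists (a, b); split=> // y [s]; rewrite /= in_itv /= => s01 <-; exists s => //.
by rewrite ray_even ray_odd.
Qed.

Lemma crossing_number_le_positive :
  exists2 k : nat, (2 * k <= #|crossing_edges positive_det3|)%N
    & (crossing_number R Kn_C4 <= k%:R%:E)%E.
Proof.
have [D DE] : exists D : drawing R Kn_C4, curve D = geodesic kronecker_ray.
  apply: geodesic_drawing.
  - exact: width_ray.
  - by move=> u v c; exact: ray_inj.
  - by move=> u v /kronecker_adjP[uv _]; exact: det2_ray.
  - by move=> u v w t c /kronecker_adjP[uv _]; exact: ray_avoid.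
pose edge (o : ('I_n * bool) * ('I_n * bool)) : {set vertex Kn_C4} :=
  [set even_vertex o.1; odd_vertex o.2]%SET.
pose X := [set [set edge o.1; edge o.2] | o in crossing_edges positive_det3]%SET.
have meet (x z y w : 'I_n * bool) (r : R * R) s t : x.1 != z.1 -> y.1 != w.1 ->
    edge (x, z) != edge (y, w) -> 0 < s < 1 -> 0 < t < 1 ->
    r = project (chord (p x) (scale3 (-1) (p z)) s) ->
    r = project (chord (p y) (scale3 (-1) (p w)) t) ->
  [/\ (x, z, (y, w)) \in crossing_edges positive_det3,
     det3 (p x) (p y) (p w) != 0 &
     (1 - s) * det3 (p x) (p y) (p w) = s * det3 (p z) (p y) (p w)].
  move=> xz yw ne s01 t01 -> e.
  have wd (a b : 'I_n * bool) m : a.1 != b.1 ->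
      width (chord (p a) (scale3 (-1) (p b)) m) != 0.
    move=> ab; apply: width_chord.
    rewrite (_ : det2 _ _ = - det2 (p a) (p b)); first by rewrite oppr_eq0 p_det2.
    by rewrite /det2 /scale3 /=; ring.
  have [c c0 h] := project_inj (wd x z s xz) (wd y w t yw) e.
  apply: (chord_crossing xz yw _ s01 t01 c0 h).
  by apply: contraNneq ne => ->.
have [||k kD kX] := @card_inj_finset _ _ (crossings D) X (fun c => c.1).
- move=> c [e [f [eE fE ef -> [ce cf]]]]; move: ce cf; rewrite DE.
  have [[x z] [xz eq_e crv_e]] := kronecker_edgeP eE;
    have [[y w] [yw eq_f crv_f]] := kronecker_edgeP fE.
  move=> /crv_e[s s01 r1] /crv_f[t t01 r2].
  have ne : edge (x, z) != edge (y, w) by rewrite /edge -eq_e -eq_f.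
  have [mem _ _] := meet _ _ _ _ _ _ _ xz yw ne s01 t01 r1 r2.
  by apply/imsetP; exists (x, z, (y, w)) => //; rewrite /edge /= -eq_e -eq_f.
(* Injectivity: two crossings of the same two edges occur at the same parameter of the first
   edge. *)
- move=> [c q] [c' q'] /set_mem[e [f [eE fE ef /= -> [ce cf]]]].
  move=> /set_mem[e' [f' [_ _ ef' /= -> [ce' cf']]]] /= eqc; congr (_, _) => //.
  have {ce' cf'}[ce' cf'] : (curve D e @` `]0, 1[ `&` curve D f @` `]0, 1[)%classic q'.
    have : e \in [set e'; f']%SET by rewrite -eqc !inE eqxx.
    have : f \in [set e'; f']%SET by rewrite -eqc !inE eqxx orbT.
    rewrite !inE => /orP[] /eqP fe /orP[] /eqP ee; move: ef; rewrite fe ee ?eqxx //.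
  move: ce cf ce' cf'; rewrite DE.
  have [[x z] [xz eq_e crv_e]] := kronecker_edgeP eE;
    have [[y w] [yw eq_f crv_f]] := kronecker_edgeP fE.
  have ne : edge (x, z) != edge (y, w) by rewrite /edge -eq_e -eq_f.
  move=> /crv_e[s s01 r1] /crv_f[t t01 r2] /crv_e[s' s01' r1'] /crv_f[t' t01' r2'].
  have [_ d0 d1] := meet _ _ _ _ _ _ _ xz yw ne s01 t01 r1 r2.
  have [_ _ d2] := meet _ _ _ _ _ _ _ xz yw ne s01' t01' r1' r2'.
  rewrite r1 r1'; congr (project (chord _ _ _)).
  move: d0 d1 d2; move: (det3 (p z) _ _) (det3 (p x) _ _) => B A A0 d1 d2.
  (* As A is nonzero, (1 - s) A = s B determines s. *)
  have AB : A = s * (A + B) by rewrite mulrDr -d1; ring.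
  have AB' : A = s' * (A + B) by rewrite mulrDr -d2; ring.
  have AB0 : A + B != 0 by apply: contra_neq A0 => h; rewrite AB h mulr0.
  by apply: (mulIf AB0); rewrite -AB -AB'.
exists k.
  apply: (@leq_trans (2 * #|X|)); first by rewrite leq_pmul2l.
  apply: card_crossing_edge_pairs; first exact: positive_det3_cycle.
  exact: positive_det3_swap.
by apply: ereal_inf_lbound; exists k => //; exists D.
Qed.

End KroneckerDrawing.

Theorem theorem4p1 (R : realType) (n : nat) (hn : (3 <= n)%N) :
  (crossing_number R (kronecker (K n) C4) <=
   (16 * (n %/ 2) * ((n - 1) %/ 2) * ((n - 2) %/ 2) * ((n - 3) %/ 2)
    + n * (n - 1) * (2 * n - 5))%N%:R%:E)%E.
Proof.
have [p [p2 p3 pc]] := exists_points R hn.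
have [k k2 le_k] := crossing_number_le_positive hn p2 p3 pc.
apply: (le_trans le_k); rewrite lee_fin ler_nat -(@leq_pmul2l 2) //.
by apply: leq_trans k2 _; exact: card_positive_crossings.
Qed.
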